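(* Let $K$ be a field, $S=K[x_1,\ldots,x_n]$, and let $u\geq_{\mathrm{lex}} v$ be two squarefree monomials of degree $2$ in $S$. Let $I=(L(u,v))$ be the lexsegment edge ideal determined by $u$ and $v$, and let $I^{\ast}$ be its Alexander dual. Then $$\operatorname{ara}(I^{\ast})=\operatorname{proj\,dim}_S(S/I^{\ast}).$$
   Context: The lexicographic order $\geq_{\mathrm{lex}}$ on monomials of $S$ is taken with $x_1>x_2>\cdots>x_n$. For squarefree monomials $u\geq_{\mathrm{lex}}v$ of degree $2$, $L(u,v)=\{w : w \text{ is a squarefree monomial of degree } 2 \text{ in } S,\ u\geq_{\mathrm{lex}} w\geq_{\mathrm{lex}} v\}$. A lexsegment edge ideal is an ideal of $S$ generated by such a set $L(u,v)$. The Alexander dual of $I=(L(u,v))$ is the squarefree monomial ideal $I^{\ast}=\bigcap_{x_ax_b\in L(u,v)}(x_a,x_b)$. For a homogeneous ideal $J\subset S$, the arithmetical rank is $\operatorname{ara}(J)=\min\{r\in\mathbb{N} : \text{there exist } a_1,\ldots,a_r\in J \text{ with } \sqrt{J}=\sqrt{(a_1,\ldots,a_r)}\}$. $\operatorname{proj\,dim}_S$ denotes projective dimension as an $S$-module. *)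

(* Defs.v *)
From HB Require Import structures.
From mathcomp Require Import all_boot all_order all_algebra.
From mathcomp Require Import ring_quotient.
From mathcomp Require Import boolp.
From mathcomp Require Import mpoly.

Set Implicit Arguments.
Unset Strict Implicit.
Unset Printing Implicit Defensive.

Import Order.TTheory GRing.Theory.
Local Open Scope ring_scope.
Local Open Scope quotient_scope.

Definition is_least (P : nat -> Prop) (r : nat) : Prop :=
  P r /\ forall m : nat, P m -> (r <= m)%N.

Section Ideals.
Variable R : comNzRingType.

Definition ideal_of (s : seq R) : {pred R} :=
  [pred f | `[< exists c : 'I_(size s) -> R,
                  f = \sum_(i < size s) c i * s`_i >]].

Definition radical (J : {pred R}) : {pred R} :=
  [pred f | `[< exists k : nat, f ^+ k \in J >]].

Definition is_ara (J : {pred R}) : nat -> Prop :=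
  is_least (fun r => exists2 a : r.-tuple R,
    {subset a <= J} & radical J =i radical (ideal_of a)).

End Ideals.

Section QuotientModule.
Variables (R : nzRingType) (V : lmodType R) (W : submodClosed V).

(* [submodClosed] does not inherit from [zmodClosed], which [Quotient.quot]
   requires; this alias of [W] carries the latter structure. *)
Definition sub_zmod : {pred V} := W.

Fact sub_zmod_closed : zmod_closed sub_zmod.
Proof. exact: submodClosedP W. Qed.

HB.instance Definition _ := GRing.isZmodClosed.Build V sub_zmod
  sub_zmod_closed.

Definition quot_mod : Type := Quotient.quot sub_zmod.

HB.instance Definition _ := Quotient.copy quot_mod (Quotient.quot sub_zmod).
HB.instance Definition _ := GRing.Zmodule.on quot_mod.

Definition quot_scale (a : R) (x : quot_mod) : quot_mod :=
  \pi_quot_mod (a *: repr x).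

Fact quot_eq (x y : V) : (\pi_quot_mod x == \pi_quot_mod y) = (x - y \in W).
Proof. exact/esym/(Quotient.idealrBE sub_zmod). Qed.

Fact pi_quotD (x y : V) :
  \pi_quot_mod x + \pi_quot_mod y = \pi_quot_mod (x + y).
Proof. by rewrite -(raddfD (\pi_(Quotient.quot sub_zmod))). Qed.

Fact pi_quotZ (a : R) (x : V) :
  quot_scale a (\pi_quot_mod x) = \pi_quot_mod (a *: x).
Proof.
by apply/eqP; rewrite quot_eq -scalerBr rpredZ // -quot_eq reprK.
Qed.

Fact quot_scaleA (a b : R) (x : quot_mod) :
  quot_scale a (quot_scale b x) = quot_scale (a * b) x.
Proof. by rewrite -[x]reprK (pi_quotZ b) !pi_quotZ scalerA. Qed.

Fact quot_scale1 : left_id 1 quot_scale.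
Proof. by move=> x; rewrite -[x]reprK pi_quotZ scale1r. Qed.

Fact quot_scaleDr : right_distributive quot_scale +%R.
Proof.
move=> a x y; rewrite -[x]reprK -[y]reprK.
by rewrite pi_quotD !pi_quotZ pi_quotD scalerDr.
Qed.

Fact quot_scaleDl (x : quot_mod) : {morph quot_scale^~ x : a b / a + b}.
Proof. by move=> a b; rewrite -[x]reprK !pi_quotZ pi_quotD scalerDl. Qed.

HB.instance Definition _ := GRing.Zmodule_isLmodule.Build R quot_mod
  quot_scaleA quot_scale1 quot_scaleDr quot_scaleDl.

End QuotientModule.

Section ProjectiveDimension.
Variable R : nzRingType.

Definition projective (P : lmodType R) : Prop :=
  forall (A B : lmodType R) (g : {linear A -> B}) (f : {linear P -> B}),
    (forall b, exists a, g a = b) ->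
  exists h : {linear P -> A}, forall x, g (h x) = f x.

(* Existence of a projective resolution 0 -> P_d -> ... -> P_0 -> M -> 0. *)
Definition projdim_le (M : lmodType R) (d : nat) : Prop :=
  exists (P : nat -> lmodType R) (diff : forall i, {linear P i.+1 -> P i})
         (aug : {linear P 0%N -> M}),
    [/\ forall i, projective (P i),
        forall i, (d < i)%N -> forall x : P i, x = 0,
        forall y, exists x, aug x = y,
        forall x, aug x = 0 <-> exists z, diff 0%N z = x
      & forall i x, diff i x = 0 <-> exists z, diff i.+1 z = x].

(* The zero module gets projective dimension 0 here. *)
Definition is_projdim (M : lmodType R) : nat -> Prop :=
  is_least (projdim_le M).

End ProjectiveDimension.

Section Lexsegment.
Variable n : nat.

Definition sqfree_deg2 : pred 'X_{1..n} :=
  [pred m : 'X_{1..n} | [forall i, m i <= 1]%N & mdeg m == 2%N].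

(* The library's lexicographic order on exponent tuples compares the exponent
   of the variable of index 0 first, i.e. 'X_0 > 'X_1 > ... > 'X_(n-1).  The
   default order [<=%O] on monomials is graded, hence not used here. *)
Definition lex_ge (u v : 'X_{1..n}) : bool :=
  ((val v : n.-tuplelexi nat) <= val u)%O.

Definition lexseg (u v : 'X_{1..n}) : pred 'X_{1..n} :=
  [pred w | [&& sqfree_deg2 w, lex_ge u w & lex_ge w v]].

Variable K : fieldType.

(* The Alexander dual of the ideal generated by the set G of squarefree
   monomials of degree 2: the intersection of the primes (x_a, x_b) over all
   x_a x_b in G.  It is a predicate on the regular module so that it carries
   a [submodClosed] structure over {mpoly K[n]}. *)
Definition alexander_dual (G : pred 'X_{1..n}) : {pred {mpoly K[n]}^o} :=
  [pred f | `[< forall a b : 'I_n, (U_(a) + U_(b))%MM \in G ->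
                  f \in ideal_of [:: 'X_a; 'X_b : {mpoly K[n]}] >]].

Fact alexander_dual_submod (G : pred 'X_{1..n}) :
  submod_closed (alexander_dual G).
Proof.
split=> [|c f g /asboolP Jf /asboolP Jg]; apply/asboolP => a b Gab.
  apply/asboolP; exists (fun=> 0).
  by rewrite big1 // => i _; rewrite mul0r.
have /asboolP[cf ->] := Jf a b Gab; have /asboolP[cg ->] := Jg a b Gab.
apply/asboolP; exists (fun i => c * cf i + cg i).
rewrite scaler_sumr -big_split /=.
by apply: eq_bigr => i _; rewrite mulrDl -mulrA.
Qed.

HB.instance Definition _ (G : pred 'X_{1..n}) :=
  GRing.isSubmodClosed.Build {mpoly K[n]} {mpoly K[n]}^o (alexander_dual G)
    (alexander_dual_submod G).

End Lexsegment.

Arguments alexander_dual {n} K G.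

(* Main.v *)
Require Import Defs.
From HB Require Import structures.
From mathcomp Require Import all_boot all_order all_algebra.
From mathcomp Require Import boolp.
From mathcomp Require Import freeg mpoly.
From mathcomp Require Import ring zify.

Set Implicit Arguments.
Unset Strict Implicit.
Unset Printing Implicit Defensive.

Import Order.TTheory GRing.Theory.
Local Open Scope ring_scope.
Local Open Scope quotient_scope.

(* The dual J of I is the cover ideal of the graph G whose edges ij, i < j, are
   those between u = x_a x_b and v = x_c x_d; both invariants lie in {2, 3}.

   Adding to a graph a vertex x whose neighbourhood N covers the edges already
   present replaces its cover ideal J' by x J' + (m), with m = prod_N x_i in J'.
   This adds one free generator and one free syzygy, and if m^k = a g + b h with
   sqrt(g, h) = sqrt J', then x g - b m and x h + a m generate x J' + (m) up to
   radical.  When G has no induced pair of disjoint edges it is built from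
   the empty graph by such steps, so both invariants are at most 2.  Otherwise
   this applies to G - a and to its part avoiding N(a), and the two are glued by
   a mapping cone, resp. by the generators x g, x h + m g, m h, giving 3.

   The bound 2 from below comes from a single edge.  The bound 3 comes from an
   induced pair of disjoint edges, i.e. from Hartshorne's example
   (a, b) /\ (c, d): a complex of projectives of length 2 has enough depth to make
   the punctured spectrum of its cokernel connected.  The same diagram chase
   applies to a resolution of S/J of length 2 and to the Koszul complex of
   two generators of J up to radical. *)

(** * Projective modules *)

Section Modules.
Variable R : comNzRingType.

Lemma linear_ex (U V : lmodType R) (f : U -> V) :
  linear f -> exists h : {linear U -> V}, h =1 f.
Proof.
move=> lf; pose m := GRing.isLinear.Build R U V *:%R f lf.
by exists (HB.pack_for {linear U -> V} f m).
Qed.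

Lemma regular_projective : projective (R^o : lmodType R).
Proof.
move=> A B g f gS; have [a ga] := gS (f 1).
have [|h hE] := @linear_ex R^o A (fun x : R^o => (x : R) *: a).
  by move=> r x y; rewrite scalerDl -scalerA.
by exists h => x; rewrite hE linearZ ga -linearZ /= [_ *: _]mulr1.
Qed.

Lemma prod_projective (P Q : lmodType R) :
  projective P -> projective Q -> projective (P * Q)%type.
Proof.
move=> pP pQ A B g f gS.
have [|fP fPE] := @linear_ex P B (fun x => f (x, 0)).
  move=> r x y; rewrite -linearP; congr (f _).
  by apply: injective_projections; rewrite //= scaler0 addr0.
have [|fQ fQE] := @linear_ex Q B (fun x => f (0, x)).
  move=> r x y; rewrite -linearP; congr (f _).
  by apply: injective_projections; rewrite //= scaler0 addr0.
have [hP hPE] := pP A B g fP gS; have [hQ hQE] := pQ A B g fQ gS.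
have [|h hE] := @linear_ex (P * Q)%type A (fun x => hP x.1 + hQ x.2).
  by move=> r x y; rewrite /= !linearP scalerDr addrACA.
exists h => -[x y]; rewrite hE linearD hPE hQE fPE fQE -linearD; congr (f _).
by apply: injective_projections; rewrite /= ?addr0 ?add0r.
Qed.

Lemma trivial_projective (P : lmodType R) :
  (forall x : P, x = 0) -> projective P.
Proof.
move=> P0 A B g f _; have [|h hE] := @linear_ex P A (fun=> 0).
  by move=> r x y; rewrite scaler0 addr0.
by exists h => x; rewrite hE (P0 x) !linear0.
Qed.

(* Membership in the submodule (s)M; for M = R^o, in the ideal (s). *)
Fixpoint smul_mem (M : lmodType R) (s : seq R) (w : M) : Prop :=
  if s is x :: s' then exists u, smul_mem s' (w - x *: u) else w = 0.

Lemma smul_mem0 (M : lmodType R) s : smul_mem s (0 : M).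
Proof. by elim: s => //= x s IH; exists 0; rewrite scaler0 subr0. Qed.

Lemma smul_memD (M : lmodType R) s (v w : M) :
  smul_mem s v -> smul_mem s w -> smul_mem s (v + w).
Proof.
elim: s v w => [|x s IH] v w /=; first by move=> -> ->; rewrite addr0.
move=> [u1 h1] [u2 h2]; exists (u1 + u2).
by rewrite scalerDr opprD addrACA; apply: IH.
Qed.

Lemma smul_mem_linear (M N : lmodType R) (h : {linear M -> N}) s (w : M) :
  smul_mem s w -> smul_mem s (h w).
Proof.
elim: s w => [|x s IH] w /=; first by move->; rewrite linear0.
by move=> [u /IH hu]; exists (h u); move: hu; rewrite linearB linearZ.
Qed.

Lemma smul_mem2 (f g h : R) :
  smul_mem [:: f; g] (h : R^o) <-> exists a b, h = a * f + b * g.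
Proof.
split=> [[a [b /= /eqP]]|[a [b ->]]].
  rewrite -addrA -opprD subr_eq0 => /eqP ->.
  by exists a, b; rewrite (mulrC a) (mulrC b).
by exists a, b; rewrite /= /GRing.scale /=; ring.
Qed.

(** That is, b is a nonzerodivisor on M / (s)M; chains of such conditions express weakly regular
    sequences. *)
Definition colon_closed (M : lmodType R) (b : R) (s : seq R) : Prop :=
  forall w : M, smul_mem s (b *: w) -> smul_mem s w.

Lemma fglift_linear (K : choiceType) (M : lmodType R) (f : K -> M) :
  linear (fglift f : {freeg K / R} -> M).
Proof.
pose m := GRing.isAdditive.Build _ _ _ (lift_is_additive f).
have [h hE] : exists h : {additive {freeg K / R} -> M}, h =1 fglift f.
  by exists (HB.pack_for {additive {freeg K / R} -> M}
               (fglift f : {freeg K / R} -> M) m).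
have hZ r (x : {freeg K / R}) : h (r *: x) = r *: h x.
  have -> : r *: x = \sum_(z <- dom x) << r * coeff z x *g z >> by [].
  rewrite -[in RHS](freeg_sumE x) !raddf_sum /=.
  by apply: eq_bigr => z _; rewrite !hE !liftU scalerA.
by move=> r x y; rewrite -!hE raddfD hZ.
Qed.

(** Lifting the identity along the evaluation map from the free module on the underlying set of P
    exhibits P as a retract of it. *)
Lemma projective_freeg (P : lmodType R) : projective P ->
  exists i : {linear P -> {freeg P / R}}, forall x, fglift idfun (i x) = x.
Proof.
have [g gE] := linear_ex (fglift_linear (idfun : P -> P)).
move=> /(_ _ _ g idfun)[x|i iE].
  by exists << 1 *g x >>; rewrite gE liftU scale1r.
by exists i => x; rewrite -gE iE.
Qed.

(** Here d need not be surjective, only reach the image of f: preimages are chosen pointwise,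
    extended linearly to the free module, and composed with the section from [projective_freeg]. *)
Lemma projective_lift (P A B : lmodType R) (d : {linear A -> B})
    (f : {linear P -> B}) : projective P ->
    (forall x, exists a, d a = f x) ->
  exists h : {linear P -> A}, forall x, d (h x) = f x.
Proof.
move=> /projective_freeg[i iE] /choice[c cE].
have [h hE] := linear_ex (fglift_linear c).
exists (h \o i) => x; rewrite /= hE -[in RHS](iE x).
have [s [r ->]] : exists s r, i x = \sum_(z <- s) << r z *g z >>.
  by exists (dom (i x)), (fun z => coeff z (i x)); rewrite freeg_sumE.
have [g gE] := linear_ex (fglift_linear (idfun : P -> P)).
rewrite -hE -gE !linear_sum; apply: eq_bigr => z _.
by rewrite hE gE !liftU !linearZ_LR cE.
Qed.

(* P is a retract of a free module, where the property is coefficientwise. *)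
Lemma projective_colon (P : lmodType R) b s :
  projective P -> colon_closed R^o b s -> colon_closed P b s.
Proof.
move=> /projective_freeg[i iE] Rbs w.
have [g gE] := linear_ex (fglift_linear (idfun : P -> P)).
pose F : lmodType R := {freeg P / R}.
move=> /(@smul_mem_linear _ _ i); rewrite linearZ.
rewrite -[w in X in _ -> X]iE -gE; move: (i w) => v bv.
apply: smul_mem_linear.
rewrite -(freeg_sumE v).
apply: (big_ind (@smul_mem F s)); [exact: smul_mem0|exact: smul_memD|].
move=> z _.
have cv : smul_mem s (coeff z v : R^o).
  apply: Rbs.
  have [|c cE] := @linear_ex F R^o (coeff z).
    by move=> r x y; rewrite raddfD /= coeffZ.
  by rewrite -cE -linearZ; apply: smul_mem_linear.
have [|u uE] := @linear_ex R^o F (fun x => << x *g z >>).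
  move=> r x y; apply/eqP/freeg_eqP => k.
  by rewrite raddfD /= coeffZ !coeffU mulrDl mulrA.
by rewrite -uE; apply: smul_mem_linear.
Qed.

End Modules.

(** * Connectedness of the punctured spectrum *)

Section LowerBounds.
Variable R : comNzRingType.

Lemma projective_cancel (P : lmodType R) (a : R) (x y : P) :
  projective P -> colon_closed R^o a [::] -> a *: x = a *: y -> x = y.
Proof.
move=> pP Ra axy; apply/eqP; rewrite -subr_eq0; apply/eqP.
by apply: (projective_colon pP Ra); rewrite /= scalerBr axy subrr.
Qed.

(* In coker d1, the classes 0 (where a or b is invertible) and e (where c or d
   is) agree on overlaps; the lemma glues them to a global s.  The obstruction
   is the Cech 2-cocycle wa, ..., wd with values in P2, which bounds by the
   colon hypotheses; k is the part of a bounding cochain that corrects ac. *)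
Lemma connectedness (P0 P1 P2 : lmodType R) (d1 : {linear P1 -> P0})
    (d2 : {linear P2 -> P1}) (a b c d : R) (e : P0) :
    projective P0 -> projective P1 -> projective P2 ->
    (forall x, d2 x = 0 -> x = 0) ->
    (forall x, d1 x = 0 <-> exists z, d2 z = x) ->
    colon_closed R^o b [:: a; c; d] -> colon_closed R^o d [:: a; c] ->
    colon_closed R^o a [:: c] -> colon_closed R^o a [::] ->
    colon_closed R^o c [::] ->
    (exists x, d1 x = (a * c) *: e) -> (exists x, d1 x = (a * d) *: e) ->
    (exists x, d1 x = (b * c) *: e) -> (exists x, d1 x = (b * d) *: e) ->
  exists s, (exists x, d1 x = a *: s) /\ (exists x, d1 x = c *: (e - s)).
Proof.
move=> pP0 pP1 pP2 d2_inj ker1 Rb Rd Rac Ra Rc.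
move=> [ac acE] [ad adE] [bc bcE] [bd bdE].
have d21 z : d1 (d2 z) = 0 by apply/ker1; exists z.
have syz r r' x y u v : d1 x = u *: e -> d1 y = v *: e -> r * u = r' * v ->
    exists w, d2 w = r *: x - r' *: y.
  move=> xE yE ruv; apply/ker1; rewrite linearB.
  by rewrite !linearZ /= xE yE scalerN !scalerA ruv subrr.
(* Each w lifts the syzygy between two of the four products; its index names their common factor. *)
have [|wa waE] := syz d c _ _ _ _ acE adE; first by ring.
have [|wb wbE] := syz d c _ _ _ _ bcE bdE; first by ring.
have [|wc wcE] := syz b a _ _ _ _ acE bcE; first by ring.
have [|wd wdE] := syz b a _ _ _ _ adE bdE; first by ring.
have telescope (A B C D : P1) : A - B - (C - D) + (B - D) - (A - C) = 0.
  by rewrite (opprB C) (addrAC (A - B)) !addrA !subrK subrr.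
(* Under [d2] the eight terms cancel in pairs, so injectivity of [d2] gives the cocycle relation. *)
have rel : b *: wa - a *: wb + c *: wd - d *: wc = 0.
  apply: d2_inj; rewrite -[RHS](telescope ((b * d) *: ac) ((b * c) *: ad)
    ((a * d) *: bc) ((a * c) *: bd)) !(linearB d2, linearD d2, linearZ_LR d2).
  rewrite waE wbE wcE wdE !scalerBr !scalerA.
  by rewrite (mulrC c b) (mulrC c a) (mulrC d b) (mulrC d a).
have /(projective_colon pP2 Rb) : smul_mem [:: a; c; d] (b *: wa).
  exists wb, (- wd), wc => /=.
  by rewrite scalerN opprK rel.
move=> [p [q [k /= /eqP]]]; rewrite subr_eq0 => /eqP wak.
(* Substituting wa = a p + c q + d k into d2 wa = d ac - c ad puts d times the corrected [ac - d2 k]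
   in (a, c) P1. *)
have : smul_mem [:: a; c] (d *: (ac - d2 k)).
  exists (d2 p), (ad + d2 q) => /=.
  have dk : d *: d2 k = d *: ac - c *: ad - a *: d2 p - c *: d2 q.
    by rewrite -waE -!(linearZ_LR d2) -!(linearB d2) wak.
  have telescope' (X Y Z W : P1) : X - (X - Y - Z - W) - Z - (Y + W) = 0.
    have -> : X - Y - Z - W = X - (Z + (Y + W)).
      by rewrite !opprD !addrA (addrAC X).
    by rewrite subKr -addrA -opprD subrr.
  by rewrite scalerBr dk scalerDr telescope'.
move=> /(projective_colon pP1 Rd)[s [t /= /eqP]]; rewrite subr_eq0 => /eqP stE.
have dE : (a * c) *: e = a *: d1 s + c *: d1 t.
  rewrite -acE -!linearZ -stE /= addrC -linearD subrK linearB d21 subr0 //.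
(* The quotient r of [c *: e - d1 s] by c is the glued section: a r = d1 t and c (e - r) = d1 s. *)
have : smul_mem [:: c] (a *: (c *: e - d1 s)).
  by exists (d1 t); rewrite /= scalerBr scalerA dE (addrC (a *: _)) addrK subrr.
move=> /(projective_colon pP0 Rac)[r /= /eqP]; rewrite subr_eq0 => /eqP rE.
exists r; split.
  exists t; apply: (projective_cancel pP0 Rc).
  rewrite scalerA (mulrC c a) -scalerA -rE scalerBr scalerA dE.
  by rewrite addrC addKr.
by exists s; rewrite scalerBr -rE subKr.
Qed.

(** In length 1 the map [d 0] is injective. Preimages x of p e and y of q e, with e a lift of
    [pi t], satisfy q x = p y, so y = q s by regularity and e is the image of s. *)
Lemma projdim_le1_colon (M : lmodType R) (pi : {linear R^o -> M}) (m : nat)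
    (p q : R) (t : R^o) : (m <= 1)%N -> projdim_le M m ->
    colon_closed R^o p [:: q] -> colon_closed R^o q [::] ->
    pi (p *: t) = 0 -> pi (q *: t) = 0 -> pi t = 0.
Proof.
move=> m1 [P [d [aug [pP P0 augS augK dK]]]] Rpq Rq pt qt.
have [e eE] := augS (pi t).
have /augK[x xE] : aug (p *: e) = 0 by rewrite linearZ_LR eE -linearZ_LR.
have /augK[y yE] : aug (q *: e) = 0 by rewrite linearZ_LR eE -linearZ_LR.
have /dK[z zE] : d 0%N (q *: x - p *: y) = 0.
  by rewrite linearB !(linearZ_LR (d 0%N)) xE yE !scalerA mulrC subrr.
have xy : q *: x - p *: y = 0 by rewrite -zE (P0 2%N _ z) ?linear0 // ltnS.
have /(projective_colon (pP 1%N) Rpq)[s] : smul_mem [:: q] (p *: y).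
  by exists x; rewrite /= -opprB xy oppr0.
move=> /= /eqP; rewrite subr_eq0 => /eqP yq.
have es : e = d 0%N s.
  by apply: (projective_cancel (pP 0%N) Rq); rewrite -yE yq linearZ_LR.
by rewrite -eE; apply/augK; exists s.
Qed.

(** [connectedness] applies to the first three terms of the resolution, as P 3 = 0 makes the last
    map injective; M is the cokernel of [df 0], so the glued section pulls back along [pi]. *)
Lemma projdim_le2_connectedness (M : lmodType R) (pi : {linear R^o -> M})
    (m : nat) (a b c d : R) (t : R^o) :
    (m <= 2)%N -> projdim_le M m -> (forall y, exists x, pi x = y) ->
    colon_closed R^o b [:: a; c; d] -> colon_closed R^o d [:: a; c] ->
    colon_closed R^o a [:: c] -> colon_closed R^o a [::] ->
    colon_closed R^o c [::] ->
    pi ((a * c) *: t) = 0 -> pi ((a * d) *: t) = 0 ->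
    pi ((b * c) *: t) = 0 -> pi ((b * d) *: t) = 0 ->
  exists s, pi (a *: s) = 0 /\ pi (c *: (t - s)) = 0.
Proof.
move=> m2 [P [df [aug [pP P0 augS augK dK]]]] piS Rb Rd Rac Ra Rc ac ad bc bd.
have [e eE] := augS (pi t).
have lift r : pi (r *: t) = 0 -> exists x, df 0%N x = r *: e.
  by move=> rt; apply/augK; rewrite linearZ_LR eE -linearZ_LR.
have inj2 (x : P 2%N) : df 1%N x = 0 -> x = 0.
  by move=> /dK[z <-]; rewrite (P0 3%N _ z) ?linear0 // ltnS.
have [s [/augK sa /augK sc]] := connectedness (pP 0%N) (pP 1%N) (pP 2%N)
  inj2 (dK 0%N) Rb Rd Rac Ra Rc (lift _ ac) (lift _ ad) (lift _ bc) (lift _ bd).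
have [t' t'E] := piS (aug s); exists t'.
split; first by rewrite linearZ_LR t'E -linearZ_LR.
by rewrite linearZ_LR (linearB pi) t'E -eE -(linearB aug) -linearZ_LR.
Qed.

(** The Koszul complex of f and g takes the place of the resolution, with e = 1; most of the proof
    is its exactness. *)
Lemma two_generated_connectedness (f g a b c d : R) :
    colon_closed R^o b [:: a; c; d] -> colon_closed R^o d [:: a; c] ->
    colon_closed R^o a [:: c] -> colon_closed R^o a [::] ->
    colon_closed R^o c [::] -> colon_closed R^o b [:: a * c] ->
    colon_closed R^o d [:: a * c] ->
    smul_mem [:: f; g] (a * c : R^o) -> smul_mem [:: f; g] (a * d : R^o) ->
    smul_mem [:: f; g] (b * c : R^o) -> smul_mem [:: f; g] (b * d : R^o) ->
  exists s : R, smul_mem [:: f; g] (a * s : R^o) /\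
    smul_mem [:: f; g] (c * (1 - s) : R^o).
Proof.
move=> Rb Rd Rac Ra Rc Rbac Rdac.
have [|d1 d1E] := @linear_ex R (R^o * R^o)%type R^o (fun x => x.1 * f + x.2 * g).
  by move=> r x y /=; rewrite /GRing.scale /=; ring.
have [|d2 d2E] := @linear_ex R R^o (R^o * R^o)%type (fun w => (w * g, - (w * f))).
  move=> r x y; apply: injective_projections; rewrite /= /GRing.scale /=; ring.
have mem_d1 (r : R) : smul_mem [:: f; g] (r : R^o) <-> exists x, d1 x = r *: (1 : R^o).
  split=> [/smul_mem2[x [y xyE]]|[[x y] xyE]].
    by exists (x, y); rewrite d1E /= -xyE /GRing.scale /= mulr1.
  by apply/smul_mem2; exists x, y; rewrite -[RHS](d1E (x, y)) xyE [RHS]mulr1.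
move=> /[dup] /smul_mem2[x [y xyE]] /mem_d1 ac /mem_d1 ad /mem_d1 bc.
move=> /[dup] /smul_mem2[x' [y' xyE']] /mem_d1 bd.
have acI (r s : R) : a * c * r = a * c * s -> r = s.
  move=> rs; apply/eqP; rewrite -subr_eq0; apply/eqP.
  by apply: Rc; apply: Ra; rewrite /= /GRing.scale /= mulrA mulrBr rs subrr.
have inj2 (w : R) : d2 w = 0 -> w = 0.
  rewrite d2E => -[wg /eqP]; rewrite oppr_eq0 => /eqP wf.
  apply: acI; rewrite mulr0 xyE.
  rewrite (_ : _ * w = x * (w * f) + y * (w * g)); last by ring.
  by rewrite wf wg !mulr0 addr0.
(* (f, g) is a regular sequence, as it contains the coprime elements
   [a * c] and [b * d]. *)
have ker1 z : d1 z = 0 <-> exists w, d2 w = z.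
  rewrite d1E; split=> [|[w <-]]; last by rewrite d2E /=; ring.
  case: z => [X Y] /= XY.
  have YX : Y * g = - (X * f) by apply/eqP; rewrite -addr_eq0 addrC XY.
  (* For X = w g and Y = - w f one gets y X - x Y = a c w, so w is sought as the quotient of y X - x
     Y by a c. The division is possible since b d times the numerator is a multiple of a c, and b
     and d cancel modulo a c. *)
  have : smul_mem [:: a * c] (y * X - x * Y : R^o).
    apply: Rbac; apply: Rdac; exists (y' * X - x' * Y).
    rewrite /= /GRing.scale /= xyE.
    rewrite (_ : d * _ = (b * d) * (y * X - x * Y)); last by ring.
    rewrite xyE' (_ : _ - _ = (x' * y - x * y') * (X * f + Y * g)); last by ring.
    by rewrite XY mulr0.
  move=> [w /= /eqP]; rewrite subr_eq0 => /eqP wE; exists w; rewrite d2E.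
  have wE' : a * c * w = y * X - x * Y by exact/esym.
  congr pair; apply: acI.
    rewrite mulrA wE' xyE (_ : _ * g = y * g * X - x * (Y * g)); last by ring.
    by rewrite YX; ring.
  have -> : a * c * - (w * f) = x * f * Y - y * (X * f).
    by rewrite mulrN mulrA wE'; ring.
  by rewrite -[X * f]opprK -YX xyE; ring.
have [s [[u uE] [v vE]]] := connectedness (@regular_projective R)
  (prod_projective (@regular_projective R) (@regular_projective R))
  (@regular_projective R) inj2 ker1 Rb Rd Rac Ra Rc ac ad bc bd.
exists s; split; apply/smul_mem2; [exists u.1, u.2|exists v.1, v.2].
  by rewrite -d1E.
by rewrite -d1E.
Qed.

End LowerBounds.

(** * Extensions of ideals *)

Section UpperBounds.
Variable R : comNzRingType.
Implicit Types (f g h x m : R) (s : seq R) (I J : R -> Prop).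

Lemma smul_memMl s f g : smul_mem s (g : R^o) -> smul_mem s (f * g : R^o).
Proof.
have [|h hE] := @linear_ex R R^o R^o (fun y => f * y).
  by move=> r y z; rewrite mulrDr /GRing.scale /= mulrCA.
by rewrite -[f * g]hE; apply: smul_mem_linear.
Qed.

Lemma smul_mem_gen s f : f \in s -> smul_mem s (f : R^o).
Proof.
elim: s => //= x s IH; rewrite inE => /predU1P[->|/IH fs].
  by exists 1; rewrite /GRing.scale /= mulr1 subrr; apply: smul_mem0.
by exists 0; rewrite scaler0 subr0.
Qed.

Definition rad_mem s f := exists k, smul_mem s (f ^+ k : R^o).

Lemma rad_mem_smul s f : smul_mem s (f : R^o) -> rad_mem s f.
Proof. by exists 1%N. Qed.

Lemma rad_memMl s f g : rad_mem s g -> rad_mem s (f * g).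
Proof. by move=> [k gk]; exists k; rewrite exprMn; apply: smul_memMl. Qed.

Lemma rad_memD s f g : rad_mem s f -> rad_mem s g -> rad_mem s (f + g).
Proof.
move=> [i fi] [j gj]; exists (i + j)%N; rewrite exprDn.
apply: (big_ind (@smul_mem _ R^o s)); [exact: smul_mem0|exact: smul_memD|].
move=> [k /= _] _; rewrite -mulr_natl; apply: smul_memMl.
have [jk|kj] := leqP j k.
  by rewrite -(subnK jk) exprD mulrA; apply: smul_memMl.
rewrite mulrC -addnBA ?(ltnW kj) // addnC exprD mulrA; exact: smul_memMl.
Qed.

Lemma rad_memX s f k : rad_mem s (f ^+ k) -> rad_mem s f.
Proof. by move=> [l fkl]; exists (k * l)%N; rewrite exprM. Qed.

Definition radical_generators J s :=
  (forall f, f \in s -> J f) /\ (forall f, J f -> rad_mem s f).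

(** A projective resolution of J of length 1, indexed as in the resolution of R/J, whose term 0 is
    R. *)
Definition ideal_pd_le1 J := exists (P1 P2 : lmodType R)
    (d1 : {linear P1 -> R^o}) (d2 : {linear P2 -> P1}),
  [/\ projective P1, projective P2, forall z, d2 z = 0 -> z = 0,
      forall y, d1 y = 0 <-> exists z, d2 z = y
    & forall f, J f <-> exists y, d1 y = f].

Section Extension.
Variables (I J : R -> Prop) (x m : R).
Hypothesis JE : forall f, J f <-> exists h k, I h /\ f = x * h + m * k.

(** The combination g (x h + a m) - h (x g - b m) equals m^(k+1), so m lies in the radical of the
    new ideal; then so do x g and x h, and with them x I. *)
Lemma extension_radical_generators g h : I m ->
  radical_generators I [:: g; h] -> exists g' h', radical_generators J [:: g'; h'].
Proof.
move=> Im [Igh Irad].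
have [k /smul_mem2[a [b mk]]] := Irad m Im.
have Ig : I g by apply: Igh; rewrite inE eqxx.
have Ih : I h by apply: Igh; rewrite !inE eqxx orbT.
exists (x * g - b * m), (x * h + a * m); set s := [:: _; _]; split=> [f|f].
  rewrite !inE => /orP[]/eqP->; apply/JE.
    by exists g, (- b); split; rewrite // mulrN (mulrC m).
  by exists h, a; split; rewrite // (mulrC m).
have gs : smul_mem s (x * g - b * m : R^o) by apply: smul_mem_gen; rewrite inE eqxx.
have hs : smul_mem s (x * h + a * m : R^o).
  by apply: smul_mem_gen; rewrite !inE eqxx orbT.
have ms : rad_mem s m.
  exists k.+1; rewrite exprSr mk.
  rewrite (_ : _ * m = g * (x * h + a * m) + - h * (x * g - b * m)); last by ring.
  by apply: smul_memD; apply: smul_memMl.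
have xgs : rad_mem s (x * g).
  rewrite -[x * g](subrK (b * m)); apply: rad_memD; last exact: rad_memMl.
  exact: rad_mem_smul.
have xhs : rad_mem s (x * h).
  rewrite -[x * h](addrK (a * m)) -mulNr; apply: rad_memD; last exact: rad_memMl.
  exact: rad_mem_smul.
move=> /JE[h0 [k0 [/Irad[l /smul_mem2[u [v h0l]]] ->]]].
apply: rad_memD; last by rewrite mulrC; apply: rad_memMl.
(* The exponent l + 1 supplies a factor x even when l = 0. *)
apply: (@rad_memX _ _ l.+1); rewrite exprMn !exprS h0l.
have -> : x * x ^+ l * (h0 * (u * g + v * h)) =
    x ^+ l * h0 * u * (x * g) + x ^+ l * h0 * v * (x * h) by ring.
by apply: rad_memD; apply: rad_memMl.
Qed.

(** With d1 c = m, the pair (- c, x) is the one new syzygy. As m is a nonzerodivisor modulo x, the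
    second component of any syzygy is a multiple of x, and subtracting a multiple of the new one
    leaves a syzygy of I. *)
Lemma extension_pd_le1 : I m -> colon_closed R^o m [:: x] ->
  colon_closed R^o x [::] -> ideal_pd_le1 I -> ideal_pd_le1 J.
Proof.
move=> Im Rm Rx [P1 [P2 [d1 [d2 [pP1 pP2 inj2 ker1 im1]]]]].
have [c cE] : exists c, d1 c = m by apply/im1.
have [|d1' d1E] := @linear_ex R (P1 * R^o)%type R^o (fun y => x * d1 y.1 + m * y.2).
  by move=> r y z /=; rewrite linearP /GRing.scale /=; ring.
have [|d2' d2E] := @linear_ex R (P2 * R^o)%type (P1 * R^o)%type
    (fun z => (d2 z.1 - z.2 *: c, x * z.2)).
  move=> r y z; apply: injective_projections => /=.
    by rewrite linearP scalerDl scalerBr scalerA addrACA opprD.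
  by rewrite mulrDr /GRing.scale /= mulrCA.
exists (P1 * R^o)%type, (P2 * R^o)%type, d1', d2'; split.
- exact: prod_projective pP1 (@regular_projective R).
- exact: prod_projective pP2 (@regular_projective R).
- move=> [z b]; rewrite d2E /= => -[zb xb].
  have b0 : b = 0 by apply: Rx.
  by move: zb; rewrite b0 scale0r subr0 => /inj2 ->.
- move=> [y b]; rewrite d1E /=; split=> [yb|[[z b'] /= []]]; last first.
    rewrite d2E => -[<- <-] /=.
    have -> : d1 (d2 z - b' *: c) = - (b' * m).
      have -> : - (b' * m) = 0 - b' *: (m : R^o) by rewrite sub0r.
      by rewrite linearB linearZ_LR cE; congr (_ - _); apply/ker1; exists z.
    by ring.
  have : smul_mem [:: x] (m * b : R^o).
    by exists (- d1 y); rewrite /= /GRing.scale /= mulrN opprK addrC.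
  move=> /Rm[b' /= /eqP]; rewrite subr_eq0 => /eqP bE.
  have : d1 (y + (b' : R) *: c) = 0.
    apply: Rx; rewrite /= linearD linearZ_LR cE -[RHS]yb bE /GRing.scale /=; ring.
  move=> /ker1[z zE]; exists (z, b').
  by rewrite d2E /= zE addrK bE.
move=> f; split=> [/JE[h [k [/im1[y yE] ->]]]|[[y b] <-]].
  by exists (y, k); rewrite d1E /= yE.
by apply/JE; exists (d1 y), b; rewrite d1E; split=> //; apply/im1; exists y.
Qed.

End Extension.

(** A Schmitt-Vogel pattern: the product of the summands x h and m g is a multiple of x g, so both
    summands lie in the radical. An f in J lies in (x, m) and has a power in (g, h), so a further
    power of f is a combination of the four products. *)
Lemma intersection_radical_generators I J x m g h :
    (forall f, J f -> I f /\ exists u v, f = x * u + m * v) ->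
    (forall f, I f -> J (x * f)) -> (forall f, I f -> J (m * f)) ->
    (forall f f', J f -> J f' -> J (f + f')) ->
    radical_generators I [:: g; h] ->
  radical_generators J [:: x * g; x * h + m * g; m * h].
Proof.
move=> JI Jx Jm JD [Igh Irad].
have Ig : I g by apply: Igh; rewrite inE eqxx.
have Ih : I h by apply: Igh; rewrite !inE eqxx orbT.
split=> [f|f Jf].
  by rewrite !inE => /or3P[]/eqP->; [exact: Jx|apply: JD; auto|exact: Jm].
set s := [:: _; _; _].
have s1 : smul_mem s (x * g : R^o) by apply: smul_mem_gen; rewrite !inE eqxx.
have s2 : smul_mem s (x * h + m * g : R^o).
  by apply: smul_mem_gen; rewrite !inE eqxx orbT.
have s3 : smul_mem s (m * h : R^o).
  by apply: smul_mem_gen; rewrite !inE eqxx !orbT.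
have xh : rad_mem s (x * h).
  exists 2%N.
  have -> : (x * h) ^+ 2 = x * h * (x * h + m * g) + - (g * x) * (m * h) by ring.
  by apply: smul_memD; apply: smul_memMl.
have mg : rad_mem s (m * g).
  rewrite -[m * g](addKr (x * h)) addrC -mulN1r.
  by apply: rad_memD; [exact: rad_mem_smul|exact: rad_memMl].
have [/Irad[l /smul_mem2[a [b fl]]] [u [v fE]]] := JI f Jf.
apply: (@rad_memX _ _ l.+1); rewrite exprS fl {1}fE.
have -> : (x * u + m * v) * (a * g + b * h) = u * a * (x * g) +
    u * b * (x * h) + (v * a * (m * g) + v * b * (m * h)) by ring.
do 2?apply: rad_memD; apply: rad_memMl => //; exact: rad_mem_smul.
Qed.

(** One statement serves lengths 2 and 3, with P3 = 0 when r = 2; the zero module ['rV[R]_0] fills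
    the higher degrees. *)
Lemma projdim_le_of_resolution (M : lmodType R) (pi : {linear R^o -> M})
    (P1 P2 P3 : lmodType R) (d1 : {linear P1 -> R^o}) (d2 : {linear P2 -> P1})
    (d3 : {linear P3 -> P2}) (r : nat) :
    projective P1 -> projective P2 -> projective P3 ->
    (forall y, exists f, pi f = y) ->
    (forall f, pi f = 0 <-> exists y, d1 y = f) ->
    (forall y, d1 y = 0 <-> exists z, d2 z = y) ->
    (forall y, d2 y = 0 <-> exists z, d3 z = y) ->
    (forall y, d3 y = 0 -> y = 0) ->
    (2 <= r)%N -> (r = 2%N -> forall y : P3, y = 0) ->
  projdim_le M r.
Proof.
move=> pP1 pP2 pP3 piS kerpi ker1 ker2 inj3 r2 P30.
pose Z : lmodType R := 'rV[R]_0.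
have Z0 (z : Z) : z = 0 by exact: thinmx0.
pose P i : lmodType R :=
  match i with 0 => R^o | 1 => P1 | 2 => P2 | 3 => P3 | _ => Z end.
have z3 : {linear Z -> P3} := \0.
have z4 : {linear Z -> Z} := \0.
pose d i : {linear P i.+1 -> P i} :=
  match i with 0 => d1 | 1 => d2 | 2 => d3 | 3 => z3 | _ => z4 end.
exists P, d, pi; split=> //.
- by case=> [|[|[|[|i]]]] //=; [exact: regular_projective|exact: trivial_projective].
- case=> [|[|[|[|i]]]] //= ri x.
  + by exfalso; move: r2 ri; clear; lia.
  + by exfalso; move: r2 ri; clear; lia.
  + by apply: P30; move: r2 ri; clear; lia.
- case=> [|[|[|[|i]]]] x //=.
  + split=> [/inj3 ->|[z <-]]; first by exists 0; rewrite linear0.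
    by rewrite (Z0 z) !linear0.
  + by split=> _; [exists 0; rewrite linear0 (Z0 x)|rewrite (Z0 x) linear0].
  + by split=> _; [exists 0; rewrite linear0 (Z0 x)|rewrite (Z0 x) linear0].
Qed.

Lemma pd_le1_projdim I (M : lmodType R) (pi : {linear R^o -> M}) :
  (forall y, exists f, pi f = y) -> (forall f, pi f = 0 <-> I f) ->
  ideal_pd_le1 I -> projdim_le M 2.
Proof.
move=> piS piI [P1 [P2 [d1 [d2 [pP1 pP2 inj2 ker1 im1]]]]].
pose Z : lmodType R := 'rV[R]_0.
have Z0 (z : Z) : z = 0 by exact: thinmx0.
have z : {linear Z -> P2} := \0.
apply: (projdim_le_of_resolution (d1 := d1) (d2 := d2) (d3 := z) (pi := pi)) => //.
- exact: trivial_projective.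
- by move=> f; rewrite piI im1.
- move=> y; split=> [/inj2 ->|[u <-]]; last by rewrite (Z0 u) !linear0.
  by exists 0; rewrite linear0.
Qed.

(** The colon hypotheses give that x I and m I' meet in x m I', so J is the cokernel of the
    injection of I' into the direct sum of I and I' sending k to (- m k, x k). The resolution is the
    mapping cone of this map, [mu] and [la] lifting multiplication by m. *)
Lemma cone_projdim I I' J x m (M : lmodType R) (pi : {linear R^o -> M}) :
    (forall y, exists f, pi f = y) -> (forall f, pi f = 0 <-> J f) ->
    (forall f, J f <-> exists h k, [/\ I h, I' k & f = x * h + m * k]) ->
    (forall f, I' f -> I (m * f)) -> (forall f, I' (x * f) -> I' f) ->
    colon_closed R^o m [:: x] -> colon_closed R^o x [::] ->
    ideal_pd_le1 I -> ideal_pd_le1 I' ->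
  projdim_le M 3.
Proof.
move=> piS piJ JE I'I I'x Rm Rx.
move=> [P1 [P2 [d1 [d2 [pP1 pP2 inj2 ker1 im1]]]]].
move=> [Q1 [Q2 [e1 [e2 [pQ1 pQ2 inje2 kere1 ime1]]]]].
have d12 z : d1 (d2 z) = 0 by apply/ker1; exists z.
have e12 z : e1 (e2 z) = 0 by apply/kere1; exists z.
have xinj (u v : R) : x * u = x * v -> u = v.
  move=> uv; apply/eqP; rewrite -subr_eq0; apply/eqP.
  by apply: Rx; rewrite /= /GRing.scale /= mulrBr uv subrr.
have [|me1 me1E] := @linear_ex R Q1 R^o (fun y => m * e1 y).
  by move=> r y z; rewrite linearP /GRing.scale /=; ring.
have [mu muE] : exists mu : {linear Q1 -> P1}, forall y, d1 (mu y) = m * e1 y.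
  have [|mu muE] := projective_lift (d := d1) (f := me1) pQ1.
    by move=> y; apply/im1; rewrite me1E; apply: I'I; apply/ime1; exists y.
  by exists mu => y; rewrite muE me1E.
have [la laE] : exists la : {linear Q2 -> P2}, forall y, d2 (la y) = mu (e2 y).
  apply: (projective_lift (d := d2) (f := mu \o e2) pQ2) => y.
  by apply/ker1; rewrite /= muE e12 mulr0.
have [|f1 f1E] := @linear_ex R (P1 * Q1)%type R^o (fun y => x * d1 y.1 + m * e1 y.2).
  by move=> r y z /=; rewrite (linearP d1) (linearP e1) /GRing.scale /=; ring.
(* The factor [Q1] is the shifted copy from the source I'; the factor [Q2] resolves the summand I'
   of the target. *)
have [|f2 f2E] := @linear_ex R (P2 * (Q1 * Q2))%type (P1 * Q1)%type
    (fun z => (d2 z.1 - mu z.2.1, x *: z.2.1 + e2 z.2.2)).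
  move=> r y z; apply: injective_projections => /=.
    by rewrite (linearP d2) (linearP mu) opprD addrACA scalerBr.
  by rewrite (linearP e2) !scalerDr !scalerA mulrC addrACA.
have [|f3 f3E] := @linear_ex R Q2 (P2 * (Q1 * Q2))%type
    (fun y => (la y, (e2 y, - (x *: y)))).
  move=> r y z; rewrite (linearP la) (linearP e2).
  do 2![apply: injective_projections => //=].
  by rewrite scalerDr opprD scalerN !scalerA mulrC.
apply: (projdim_le_of_resolution (d1 := f1) (d2 := f2) (d3 := f3) (pi := pi)) => //.
- exact: prod_projective.
- by apply: prod_projective => //; apply: prod_projective.
- move=> f; rewrite piJ JE; split=> [[h [k [/im1[y <-] /ime1[z <-] ->]]]|[[y z] <-]].
    by exists (y, z); rewrite f1E.
  exists (d1 y), (e1 z); rewrite f1E; split=> //; first by apply/im1; exists y.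
  by apply/ime1; exists z.
- move=> [y z]; rewrite f1E /=; split=> [yz|[[w [u v]]]]; last first.
    rewrite f2E /= => -[<- <-].
    rewrite (linearB d1) d12 muE (linearD e1) e12 (linearZ_LR e1) addr0 sub0r.
    by rewrite /GRing.scale /=; ring.
  have : smul_mem [:: x] (m * e1 z : R^o).
    by exists (- d1 y); rewrite /= /GRing.scale /= mulrN opprK addrC.
  move=> /Rm[k /= /eqP]; rewrite subr_eq0 => /eqP kE.
  have [u uE] : exists u, e1 u = k.
    by apply/ime1; apply: I'x; apply/ime1; exists z.
  have /kere1[v vE] : e1 (z - x *: u) = 0.
    by rewrite linearB linearZ_LR uE kE subrr.
  have /ker1[w wE] : d1 (y + mu u) = 0.
    apply: xinj; rewrite (linearD d1) muE uE mulr0 -yz kE /GRing.scale /=; ring.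
  by exists (w, (u, v)); rewrite f2E /= wE vE addrK addrC subrK.
- move=> [w [u v]]; rewrite f2E /=; split=> [[wu uv]|[y]]; last first.
    by rewrite f3E => -[<- <- <-] /=; rewrite laE linearN linearZ_LR !subrr.
  have /kere1[y yE] : e1 u = 0.
    apply: xinj; rewrite mulr0 -[LHS]/(x *: (e1 u)) -linearZ_LR.
    by rewrite -[X in e1 X](addrK (e2 v)) uv sub0r linearN e12 oppr0.
  exists y; rewrite f3E yE; congr pair.
    apply/eqP; rewrite -subr_eq0; apply/eqP/inj2.
    by rewrite linearB laE yE; apply/eqP; rewrite subr_eq0 eq_sym -subr_eq0 wu.
  congr pair; apply/eqP; rewrite eq_sym -subr_eq0 opprK; apply/eqP/inje2.
  by rewrite linearD linearZ_LR yE addrC.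
- by move=> y; rewrite f3E => -[_ /inje2].
Qed.

End UpperBounds.

(** * Cover ideals of graphs *)

Section CoverIdeals.
Variables (K : fieldType) (n : nat).
Local Notation S := {mpoly K[n]}.
Implicit Types (f g h : S) (k m : 'X_{1..n}) (E : rel 'I_n) (A : pred 'I_n).

Lemma msupp_mulX m f k : (k \in msupp ('X_[m] * f)) =
  (k \in [seq (m + k')%MM | k' <- msupp f]).
Proof. by rewrite mulrC (perm_mem (msuppMX _ _)). Qed.

Lemma mem_msupp_mulX m f k : k \in msupp f -> (m + k)%MM \in msupp ('X_[m] * f).
Proof. by move=> kf; rewrite msupp_mulX map_f. Qed.

Lemma smul_mem_monomials (s : seq 'X_{1..n}) f :
  smul_mem [seq 'X_[m] | m <- s] (f : S^o) <->
  forall k, k \in msupp f -> has (fun m => m <= k)%MM s.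
Proof.
split=> [|sf].
  elim: s f => [|m s IH] f /= => [->|[u /IH fu]] k; first by rewrite msupp0.
  rewrite -[f](subrK ('X_[m] * u)) => /msuppD_le; rewrite mem_cat => /orP[].
    by move=> /fu ->; rewrite orbT.
  by rewrite msupp_mulX => /mapP[k' _ ->]; rewrite lem_addr.
rewrite [f]mpolyE big_seq.
apply: (big_ind (@smul_mem _ S^o _)); [exact: smul_mem0|exact: smul_memD|].
move=> k /sf/hasP[m ms mk]; rewrite -(submK mk) mpolyXD -mul_mpolyC mulrA.
by apply: smul_memMl; apply: smul_mem_gen; rewrite map_f.
Qed.

(** Source of all the [colon_closed] hypotheses over S: coprime monomials can be cancelled exponent
    by exponent in a divisibility. *)
Lemma monomial_colon m (s : seq 'X_{1..n}) :
  (forall m' i, m' \in s -> (m i == 0%N) || (m' i == 0%N)) ->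
  @colon_closed S S^o 'X_[m] [seq 'X_[m'] | m' <- s].
Proof.
move=> ms f /smul_mem_monomials mf; apply/smul_mem_monomials => k kf.
have /hasP[m' m's m'k] := mf _ (mem_msupp_mulX m kf).
apply/hasP; exists m' => //; apply/mnm_lepP => i.
have := mnm_lepP m'k i; rewrite mnmDE.
by case/orP: (ms m' i m's) => /eqP->.
Qed.

(** The intersection of the primes (x_i, x_j) over the edges ij, tested monomial by monomial: each
    support is a vertex cover. *)
Definition cover_ideal E f := forall k, k \in msupp f ->
  forall i j, E i j -> (0 < k i)%N || (0 < k j)%N.

Lemma cover_ideal0 E : cover_ideal E 0.
Proof. by move=> k; rewrite msupp0. Qed.

Lemma cover_idealD E f g :
  cover_ideal E f -> cover_ideal E g -> cover_ideal E (f + g).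
Proof.
move=> Ef Eg k /msuppD_le; rewrite mem_cat => /orP[/Ef|/Eg]; exact.
Qed.

Lemma cover_idealMl E f g : cover_ideal E g -> cover_ideal E (f * g).
Proof.
move=> Eg k /msuppM_le/allpairsP[[k1 k2] /= [_ /Eg gk ->]] i j /gk.
by rewrite !mnmDE !addn_gt0 => /orP[]->; rewrite ?orbT.
Qed.

Definition prod_monomial A : 'X_{1..n} := [multinom (i \in A : nat) | i < n].

Lemma prod_monomialE A i : prod_monomial A i = (i \in A).
Proof. exact: mnmE. Qed.

Lemma prod_monomial_le A k :
  (forall i, i \in A -> (0 < k i)%N) -> (prod_monomial A <= k)%MM.
Proof.
move=> Ak; apply/mnm_lepP => i; rewrite prod_monomialE.
by case: (boolP (i \in A)) => // /Ak.
Qed.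

Lemma cover_ideal_monomialM E m f :
  (forall k, k \in msupp f ->
     forall i j, E i j -> (0 < m i + k i)%N || (0 < m j + k j)%N) <->
  cover_ideal E ('X_[m] * f).
Proof.
split=> [mf k|mf k kf i j ij].
  by rewrite msupp_mulX => /mapP[k' kf ->] i j ij; rewrite !mnmDE mf.
by have := mf _ (mem_msupp_mulX m kf) i j ij; rewrite !mnmDE.
Qed.

(** When no edge ends in x, this deletes the vertex x. *)
Definition del_source E x : rel 'I_n := [rel i j | E i j && (i != x)].
Definition avoid E A : rel 'I_n := [rel i j | [&& E i j, i \notin A & j \notin A]].

Section Split.
Variables (E : rel 'I_n) (x : 'I_n).
Hypothesis Ex : forall i, ~~ E i x.
Let E' := del_source E x.
Let m := prod_monomial (E x).
Let E'' := avoid E' (E x).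

(** A cover either contains x, and the rest covers the graph without x; or it contains all
    neighbours of x, and the rest covers the edges that avoid them. *)
Lemma cover_split f : cover_ideal E f <->
  exists g h, [/\ cover_ideal E' g, cover_ideal E'' h & f = 'X_x * g + 'X_[m] * h].
Proof.
split=> [Ef|[g [h [Eg Eh ->]]]]; last first.
  apply: cover_idealD; apply/cover_ideal_monomialM => k kf i j ij.
    rewrite !mnm1E; have [//|ix] := eqVneq x i.
    have := Eg k kf i j; rewrite /E' /del_source /= ij eq_sym ix => /(_ isT).
    by rewrite !addn_gt0 => /orP[]->; rewrite ?orbT.
  rewrite !prod_monomialE; have [ix|ix] := eqVneq i x.
    by rewrite -ix [j \in _]ij orbT.
  have [//|iA] := boolP (i \in E x); have [|jA] := boolP (j \in E x).
    by rewrite orbT.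
  rewrite !add0n; apply: (Eh k kf).
  by rewrite /E'' /avoid /E' /del_source /= ij ix iA jA.
pose Q f := exists g h,
  [/\ cover_ideal E' g, cover_ideal E'' h & f = 'X_x * g + 'X_[m] * h].
rewrite [f]mpolyE big_seq; apply: (big_ind Q).
- by exists 0, 0; split; rewrite ?mulr0 ?addr0 //; exact: cover_ideal0.
- move=> _ _ [g1 [h1 [Eg1 Eh1 ->]]] [g2 [h2 [Eg2 Eh2 ->]]].
  exists (g1 + g2), (h1 + h2); split; [exact: cover_idealD|exact: cover_idealD|].
  by rewrite !mulrDr addrACA.
move=> k kf; have [kx|kx] := posnP (k x).
  have mk : (m <= k)%MM.
    by apply: prod_monomial_le => i xi; have := Ef k kf x i xi; rewrite kx.
  exists 0, (f@_k *: 'X_[k - m]); split; first exact: cover_ideal0.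
    rewrite -mul_mpolyC; apply: cover_idealMl => k'; rewrite msuppX inE => /eqP-> i j.
    rewrite /E'' /avoid /E' /del_source /= => /and3P[/andP[ij _] iA jA].
    by rewrite !mnmBE !prod_monomialE (negbTE iA) (negbTE jA) !subn0; apply: Ef.
  by rewrite mulr0 add0r -scalerAr -mpolyXD addmC submK.
have xk : (U_(x) <= k)%MM.
  by apply/mnm_lepP => i; rewrite mnm1E; case: eqP => // <-.
exists (f@_k *: 'X_[k - U_(x)]), 0; split; last 2 first.
- exact: cover_ideal0.
- by rewrite mulr0 addr0 -scalerAr -mpolyXD addmC submK.
rewrite -mul_mpolyC; apply: cover_idealMl => k'; rewrite msuppX inE => /eqP-> i j.
rewrite /E' /del_source /= => /andP[ij ix]; rewrite !mnmBE !mnm1E.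
have jx : j != x by apply: contraL ij => /eqP->.
by rewrite 2![x == _]eq_sym (negbTE ix) (negbTE jx) !subn0; apply: Ef.
Qed.

Lemma cover_del_source f : cover_ideal E f -> cover_ideal E' f.
Proof. by move=> Ef k kf i j /andP[ij _]; apply: Ef. Qed.

Lemma cover_mulX f : cover_ideal E' f -> cover_ideal E ('X_x * f).
Proof.
move=> Ef; apply/cover_split; exists f, 0; split=> //.
  exact: cover_ideal0.
by rewrite mulr0 addr0.
Qed.

Lemma cover_mulm f : cover_ideal E'' f -> cover_ideal E ('X_[m] * f).
Proof.
move=> Ef; apply/cover_split; exists 0, f; split=> //.
  exact: cover_ideal0.
by rewrite mulr0 add0r.
Qed.

Lemma cover_avoid_colon f : cover_ideal E'' ('X_x * f) -> cover_ideal E'' f.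
Proof.
move=> /cover_ideal_monomialM Ef k kf i j ij; have := Ef k kf i j ij.
case/and3P: ij => /andP[ij ix] _ _.
have jx : j != x by apply: contraL ij => /eqP->.
by rewrite !mnm1E 2![x == _]eq_sym (negbTE ix) (negbTE jx) !add0n.
Qed.

Lemma prod_monomial_colon : @colon_closed S S^o 'X_[m] [:: 'X_x].
Proof.
apply: (@monomial_colon m [:: U_(x)%MM]) => m' i; rewrite inE => /eqP->.
rewrite mnm1E prod_monomialE; have [<-|_] := eqVneq x i; last by rewrite orbT.
by rewrite unfold_in (negbTE (Ex x)).
Qed.

End Split.

End CoverIdeals.

(** * Upper bounds for cover ideals *)

Section CoverInvariants.
Variables (K : fieldType) (n : nat).
Local Notation S := {mpoly K[n]}.
Implicit Types (f g h : S) (k m : 'X_{1..n}) (E : rel 'I_n).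

(** The upper bound 2 for both invariants, in a form that passes through the extension steps. *)
Definition height2_tame E :=
  ideal_pd_le1 (@cover_ideal K n E) /\
  exists g h : S, radical_generators (cover_ideal E) [:: g; h].

Lemma eq_cover_ideal E E' : E =2 E' -> @cover_ideal K n E = cover_ideal E'.
Proof. by move=> EE'; congr cover_ideal; apply/funext => i; apply/funext. Qed.

Lemma X_regular x : @colon_closed S S^o 'X_x [::].
Proof. exact: (@monomial_colon K n U_(x)%MM [::]). Qed.

Lemma no_edge_tame E : (forall i j, ~~ E i j) -> height2_tame E.
Proof.
move=> E0.
have cE f : cover_ideal E f by move=> k _ i j; rewrite (negbTE (E0 i j)).
split.
  pose Z : lmodType S := 'rV[S]_0.
  have Z0 (z : Z) : z = 0 by exact: thinmx0.
  exists S^o, Z, idfun, \0; split.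
  - exact: regular_projective.
  - exact: trivial_projective.
  - by [].
  - move=> y; split=> [/= ->|[z <-]]; last by rewrite (Z0 z) linear0.
    by exists 0.
  - by move=> f; split=> // _; exists f.
(* Without edges the ideal is all of S; the 0 only fills the second place. *)
exists 1, 0; split=> [f _|f _]; first exact: cE.
by apply: rad_mem_smul; apply/smul_mem2; exists f, 0; rewrite mulr1 mul0r addr0.
Qed.

(* The sources of edges are added by increasing key; the last hypothesis says
   that the edges out of i end in a vertex cover of the edges added before. *)
Lemma elimination_tame E (key : 'I_n -> nat) :
    (forall i i' j j', E i j -> E i' j' -> key i = key i' -> i = i') ->
    (forall i, ~~ E i i) ->
    (forall i i' j j', E i j -> E i' j' -> (key i' < key i)%N ->
       ~~ E i' i && (E i i' || E i j')) ->
  height2_tame E.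
Proof.
move=> key_inj Eirr Ecov.
pose Ek b : rel 'I_n := [rel i j | E i j && (key i < b)%N].
suff Ekg b : height2_tame (Ek b).
  have [b Eb] : exists b, Ek b =2 E.
    exists (\max_i key i).+1 => i j; rewrite /Ek /= ltnS leq_bigmax andbT //.
  have := Ekg b; rewrite /height2_tame (eq_cover_ideal Eb); exact.
elim: b => [|b IH]; first by apply: no_edge_tame => i j; rewrite /Ek /= ltn0 andbF.
have [[x [y /andP[xy /eqP xb]]]|Eb0] :=
    pselect (exists x y, E x y && (key x == b)); last first.
  have Eb : Ek b.+1 =2 Ek b.
    move=> i j; rewrite /Ek /= ltnS leq_eqVlt; case: eqP => //= ib.
    rewrite ib ltnn !andbT andbF; apply/negbTE/negP => ij.
    by apply: Eb0; exists i, j; rewrite ij ib eqxx.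
  by rewrite /height2_tame (eq_cover_ideal Eb).
have Ex i : ~~ Ek b.+1 i x.
  apply/negP; rewrite /Ek /= => /andP[ix]; rewrite ltnS leq_eqVlt => /orP[/eqP ib|ib].
    by move: (Eirr x); rewrite -{1}(key_inj i x x y) // ?ix ?ib.
  by have := Ecov x i y x xy ix; rewrite xb ib ix => /(_ isT).
have Exj j : Ek b.+1 x j = E x j by rewrite /Ek /= xb ltnSn andbT.
have dE : del_source (Ek b.+1) x =2 Ek b.
  move=> i j; rewrite /del_source /Ek /= ltnS -andbA; case: (boolP (E i j)) => //= ij.
  have [->|ix] := eqVneq i x; first by rewrite xb ltnn andbF.
  rewrite andbT leq_eqVlt; case: eqP => //= ib.
  by case/eqP: ix; apply: key_inj ij xy _; rewrite ib.
(* The neighbours of x cover all earlier edges, so no edge avoids them, and the second term of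
   [cover_split] becomes the principal ideal (m). *)
have aE i j : ~~ avoid (del_source (Ek b.+1) x) (Ek b.+1 x) i j.
  apply/negP => /and3P[]; rewrite dE => /andP[ij ib].
  rewrite -[_ \in _]/(Ek b.+1 x i) -[_ \in _]/(Ek b.+1 x j) !Exj => xi xj.
  have := Ecov x i y j xy ij; rewrite xb => /(_ ib) /andP[_].
  by rewrite (negbTE xi) (negbTE xj).
pose m := prod_monomial (Ek b.+1 x).
have split f : cover_ideal (Ek b.+1) f <->
    exists g h, cover_ideal (Ek b) g /\ f = 'X_x * g + 'X_[m] * h.
  rewrite (cover_split Ex) (eq_cover_ideal dE).
  split=> [[g [h [gE _ ->]]]|[g [h [gE ->]]]].
    by exists g, h.
  by exists g, h; split=> // k _ i j; rewrite (negbTE (aE i j)).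
have mE : cover_ideal (Ek b) ('X_[m] : S).
  rewrite -(eq_cover_ideal dE); apply: cover_del_source.
  rewrite -[X in cover_ideal _ X]mulr1; apply: cover_mulm => // k _ i j.
  by rewrite (negbTE (aE i j)).
have [rE [g [h gh]]] := IH; split.
  apply: (extension_pd_le1 split mE _ (@X_regular x) rE).
  exact: prod_monomial_colon.
exact: (extension_radical_generators split mE gh).
Qed.

Section Cone.
Variables (E : rel 'I_n) (x : 'I_n).
Hypothesis Ex : forall i, ~~ E i x.
Let E' := del_source E x.
Let E'' := avoid E' (E x).
Hypotheses (E'tame : height2_tame E') (E''tame : height2_tame E'').

(** By [cover_split], J lies in J' and in (x, m), and contains x J' and m J', where J' is the cover
    ideal of [E']. *)
Lemma cone_radical_generators :
  exists s : seq S, size s = 3%N /\ radical_generators (cover_ideal E) s.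
Proof.
have [_ [g [h gh]]] := E'tame.
exists [:: 'X_x * g; 'X_x * h + 'X_[prod_monomial (E x)] * g;
           'X_[prod_monomial (E x)] * h]; split=> //.
apply: intersection_radical_generators gh => [f Ef|f|f Ef|f f'].
- split; first exact: cover_del_source.
  by have /(cover_split Ex)[u [v [_ _ ->]]] := Ef; exists u, v.
- exact: cover_mulX.
- by apply: cover_mulm => // k kf i j /and3P[ij _ _]; apply: Ef ij.
- exact: cover_idealD.
Qed.

Lemma cone_projdim_le (M : lmodType S) (pi : {linear S^o -> M}) :
  (forall y, exists f, pi f = y) -> (forall f, pi f = 0 <-> cover_ideal E f) ->
  projdim_le M 3.
Proof.
move=> piS piE; have [[rE' _] [rE'' _]] := (E'tame, E''tame).
apply: (cone_projdim (x := 'X_x) (m := 'X_[prod_monomial (E x)]) piS piE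
  (cover_split Ex) _ _ _ _ rE' rE'').
- by move=> f Ef; apply: cover_del_source; apply: cover_mulm.
- exact: cover_avoid_colon.
- exact: prod_monomial_colon.
- exact: X_regular.
Qed.

End Cone.

(** * Lower bounds from an edge and from an induced pair of disjoint edges *)

Lemma cover_ideal_monomial E k :
  (forall i j, E i j -> (0 < k i)%N || (0 < k j)%N) ->
  cover_ideal E ('X_[k] : S).
Proof. by move=> kE k'; rewrite msuppX inE => /eqP->. Qed.

Lemma monomial_cover_ideal E k : cover_ideal E ('X_[k] : S) ->
  forall i j, E i j -> (0 < k i)%N || (0 < k j)%N.
Proof. by apply; rewrite msuppX inE. Qed.

(** Exponents are general because generation up to radical controls only powers of the variables. *)
Lemma Xs_colon r (s : seq 'I_n) M N : r \notin s ->
  @colon_closed S S^o ('X_r ^+ M) [seq 'X_r' ^+ N | r' <- s].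
Proof.
move=> rs; have -> : [seq ('X_r' : S) ^+ N | r' <- s] =
    [seq 'X_[m] | m <- [seq (U_(r') *+ N)%MM | r' <- s]].
  by rewrite -map_comp; apply: eq_map => r' /=; rewrite mpolyXn.
rewrite mpolyXn; apply: monomial_colon => m i /mapP[r' r's ->].
rewrite !mulmnE !mnm1E; have [<-|_] := eqVneq r i; last by rewrite mul0n.
by have [rr'|_] := eqVneq r' r; [rewrite -rr' r's in rs|rewrite mul0n orbT].
Qed.

Lemma X_prod_colon r p q N : r != p -> r != q ->
  @colon_closed S S^o ('X_r ^+ N) [:: 'X_p ^+ N * 'X_q ^+ N].
Proof.
move=> rp rq; rewrite !mpolyXn -mpolyXD.
apply: (@monomial_colon K n (U_(r) *+ N)%MM [:: (U_(p) *+ N + U_(q) *+ N)%MM]) => m i.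
rewrite inE => /eqP->; rewrite mnmDE !mulmnE !mnm1E.
have [<-|_] := eqVneq r i; last by rewrite mul0n.
by rewrite [p == r]eq_sym [q == r]eq_sym (negbTE rp) (negbTE rq) !mul0n addn0 orbT.
Qed.

Lemma monomial_neq0 k : 'X_[k] != 0 :> S.
Proof. by rewrite -msupp_eq0 msuppX. Qed.

Lemma smul_mem1 f g : smul_mem [:: f] (g : S^o) <-> exists u, g = f * u.
Proof.
split=> [[u /= /eqP]|[u ->]]; first by rewrite subr_eq0 => /eqP; exists u.
by exists u; rewrite /= /GRing.scale /= subrr.
Qed.

Section Edge.
Variables (E : rel 'I_n) (p q : 'I_n).
Hypotheses (Epq : E p q) (Eirr : forall i, ~~ E i i).

(** The class of t in S/J is killed by x_p and x_q, yet no power of t lies in J. *)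
Let t := prod_monomial [predC [:: p; q]].

Let tp : t p = 0%N. Proof. by rewrite prod_monomialE !inE eqxx. Qed.
Let tq : t q = 0%N. Proof. by rewrite prod_monomialE !inE eqxx orbT. Qed.

Let pq : p != q. Proof. by apply: contraL Epq => /eqP->. Qed.

Let cover_t r : r \in [:: p; q] -> cover_ideal E ('X_r * 'X_[t] : S).
Proof.
move=> rpq; rewrite -mpolyXD; apply: cover_ideal_monomial => i j ij.
have ij' : i != j by apply: contraL ij => /eqP->.
rewrite !mnmDE !mnm1E !prod_monomialE !inE; move: ij' rpq; rewrite !inE -!val_eqE /=.
lia.
Qed.

Let cover_tN (N : nat) : ~ cover_ideal E ('X_[t] ^+ N : S).
Proof.
rewrite mpolyXn => /monomial_cover_ideal/(_ _ _ Epq).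
by rewrite !mulmnE tp tq.
Qed.

(** A single radical generator f divides x_p^N t^N and x_q^N t^N for some N. Comparing the
    quotients, coprimality of x_p^N and x_q^N makes f divide t^N, which is not in J. The empty list
    fails since powers of monomials are nonzero. *)
Lemma edge_radical_generators (s : seq S) :
  radical_generators (cover_ideal E) s -> (1 < size s)%N.
Proof.
move=> [sE rad_s]; case: s => [|f [|//]] in sE rad_s *.
  have [N /= /eqP] := rad_s _ (cover_t (mem_head _ _)).
  by rewrite -mpolyXD mpolyXn (negbTE (monomial_neq0 _)).
have [k /smul_mem1[u uE]] := rad_s _ (cover_t (mem_head _ _)).
have [l /smul_mem1[v vE]] := rad_s _ (cover_t (mem_last p [:: q])).
set N := (k + l)%N.
have [u' u'E] : exists u', 'X_p ^+ N * 'X_[t] ^+ N = f * u'.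
  by exists (u * ('X_p * 'X_[t]) ^+ l); rewrite -exprMn exprD uE mulrA.
have [v' v'E] : exists v', 'X_q ^+ N * 'X_[t] ^+ N = f * v'.
  by exists (v * ('X_q * 'X_[t]) ^+ k); rewrite -exprMn /N addnC exprD vE mulrA.
have Xpq : @colon_closed S S^o ('X_p ^+ N) [:: 'X_q ^+ N].
  by apply: (@Xs_colon p [:: q] N N); rewrite inE.
have XN r : 'X_r ^+ N != 0 :> S by rewrite mpolyXn monomial_neq0.
have f0 : f != 0.
  apply: contra_neq (mulf_neq0 (XN p) (_ : 'X_[t] ^+ N != 0 :> S)); last first.
    by rewrite mpolyXn monomial_neq0.
  by rewrite u'E => ->; rewrite mul0r.
have /Xpq/smul_mem1[w wE] : smul_mem [:: 'X_q ^+ N] ('X_p ^+ N * v' : S^o).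
  apply/smul_mem1; exists u'; apply: (mulfI f0).
  by rewrite mulrCA -v'E [in RHS]mulrCA -u'E mulrCA.
exfalso; apply: (@cover_tN N); have -> : 'X_[t] ^+ N = w * f.
  by apply: (mulfI (XN q)); rewrite v'E wE mulrCA (mulrC f).
by apply: cover_idealMl; apply: sE; rewrite mem_head.
Qed.

Lemma edge_projdim (M : lmodType S) (pi : {linear S^o -> M}) (m : nat) :
  (forall f, pi f = 0 <-> cover_ideal E f) -> projdim_le M m -> (1 < m)%N.
Proof.
move=> piE Mm; rewrite ltnNge; apply/negP => m1.
have /piE : pi 'X_[t] = 0.
  apply: (projdim_le1_colon m1 Mm (p := 'X_p) (q := 'X_q)).
  - by apply: (@Xs_colon p [:: q] 1 1); rewrite inE.
  - exact: X_regular.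
  - by apply/piE; apply: cover_t; rewrite mem_head.
  - by apply/piE; apply: cover_t; rewrite !inE eqxx orbT.
exact: (@cover_tN 1).
Qed.

End Edge.

(** A substitute for localization: setting the variables outside A to 1 removes the factor t from
    membership statements. *)
Lemma specialize_to_one (A : pred 'I_n) : exists psi : {rmorphism S -> S},
  (forall i, i \in A -> psi 'X_i = 'X_i) /\
  psi 'X_[prod_monomial [predC A]] = 1.
Proof.
pose lq := [tuple if i \in A then 'X_i else 1 : S | i < n].
exists (comp_mpoly lq); split=> [i iA|] /=.
  by rewrite comp_mpolyXU -tnth_nth tnth_mktuple iA.
rewrite comp_mpolyX big1 // => i _.
by rewrite tnth_mktuple prod_monomialE inE; case: (i \in A); rewrite ?expr0 ?expr1.
Qed.

Lemma smul_mem_rmorph (psi : {rmorphism S -> S}) (s : seq S) f :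
  smul_mem s (f : S^o) -> smul_mem (map psi s) (psi f : S^o).
Proof.
elim: s f => [|x s IH] f /=; first by move=> ->; rewrite rmorph0.
by move=> [u /IH]; rewrite rmorphB rmorphM => fu; exists (psi u).
Qed.

Lemma smul_mem_pad (s : seq S) f : (size s <= 2)%N ->
  smul_mem s (f : S^o) -> smul_mem [:: s`_0; s`_1] (f : S^o).
Proof.
case: s => [|x [|y [|//]]] _ //=.
  by move=> ->; apply: (@smul_mem0 _ S^o [:: 0; 0]).
by move=> [u fu]; exists u, 0; rewrite scaler0 subr0.
Qed.

Section InducedMatching.
Variables (E : rel 'I_n) (a b c d : 'I_n).
Hypotheses (abcd : uniq [:: a; b; c; d]) (Eab : E a b) (Ecd : E c d).
Hypotheses (Eirr : forall i, ~~ E i i)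
  (induced : forall i j, E i j -> i \in [:: a; b; c; d] -> j \in [:: a; b; c; d] ->
     (i \in [:: a; b]) && (j \in [:: a; b]) ||
     (i \in [:: c; d]) && (j \in [:: c; d])).

Let t := prod_monomial [predC [:: a; b; c; d]].

(** An edge missed by t has both ends among the four vertices, hence is ab or cd up to orientation,
    and contains p or q. *)
Let cover_t p q : p \in [:: a; b] -> q \in [:: c; d] ->
  cover_ideal E ('X_p * 'X_q * 'X_[t] : S).
Proof.
move=> pab qcd; rewrite -!mpolyXD; apply: cover_ideal_monomial => i j ij.
have ij' : i != j by apply: contraL ij => /eqP->.
have pair x y r : i \in [:: x; y] -> j \in [:: x; y] -> r \in [:: x; y] ->
    (r == i) || (r == j).
  move=> ix jx rx; move: ix jx rx ij'; rewrite !inE.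
  by move=> /pred2P[->|->] /pred2P[->|->] /pred2P[->|->]; rewrite ?eqxx ?orbT.
rewrite !mnmDE !mnm1E !prod_monomialE !addn_gt0 !lt0b ![_ \in [predC _]]inE /=.
have [iabcd|] := boolP (i \in _); last by rewrite orbT.
have [jabcd|] := boolP (j \in _); last by rewrite !orbT.
have /orP[/andP[ix jx]|/andP[ix jx]] := induced ij iabcd jabcd.
  by case/orP: (pair _ _ p ix jx pab) => ->; rewrite ?orbT.
by case/orP: (pair _ _ q ix jx qcd) => ->; rewrite ?orbT.
Qed.

Let neq6 : [&& a != b, a != c, a != d, b != c, b != d & c != d].
Proof.
move: abcd; rewrite /= !inE !negb_or !andbT.
by move=> /and3P[/and3P[-> -> ->] /andP[-> ->] ->].
Qed.

Let neqs : [/\ b \notin [:: a; c; d], d \notin [:: a; c] & a \notin [:: c]].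
Proof.
rewrite !inE !negb_or; move: neq6.
rewrite [b == a]eq_sym [d == a]eq_sym [d == c]eq_sym.
by move=> /and5P[-> -> -> -> /andP[-> ->]].
Qed.

Lemma matching_projdim (M : lmodType S) (pi : {linear S^o -> M}) (m : nat) :
  (forall y, exists f, pi f = y) -> (forall f, pi f = 0 <-> cover_ideal E f) ->
  projdim_le M m -> (2 < m)%N.
Proof.
move=> piS piE Mm; rewrite ltnNge; apply/negP => m2.
have [? ? ?] := neqs; have /and5P[_ ac ad bc /andP[bd _]] := neq6.
have tE p q : p \in [:: a; b] -> q \in [:: c; d] ->
    pi (('X_p * 'X_q : S) *: ('X_[t] : S^o)) = 0.
  by move=> pab qcd; apply/piE; apply: cover_t.
have [] := projdim_le2_connectedness (a := 'X_a) (b := 'X_b) (c := 'X_c)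
  (d := 'X_d) (t := 'X_[t] : S^o) m2 Mm piS.
- exact: (@Xs_colon b [:: a; c; d] 1 1).
- exact: (@Xs_colon d [:: a; c] 1 1).
- exact: (@Xs_colon a [:: c] 1 1).
- exact: X_regular.
- exact: X_regular.
- by apply: tE; rewrite !inE eqxx ?orbT.
- by apply: tE; rewrite !inE eqxx ?orbT.
- by apply: tE; rewrite !inE eqxx ?orbT.
- by apply: tE; rewrite !inE eqxx ?orbT.
move=> s [/piE/cover_ideal_monomialM sa /piE/cover_ideal_monomialM sc].
have t0 r : r \in [:: a; b; c; d] -> t r = 0%N.
  by move=> rabcd; rewrite prod_monomialE inE /= rabcd.
(* The monomial t occurs in s or in t - s; but x_a t does not cover cd, and x_c t does not cover
   ab. *)
have : t \in msupp ('X_[t] - s + s) by rewrite subrK msuppX inE.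
move=> /msuppD_le; rewrite mem_cat => /orP[/sc/(_ _ _ Eab)|/sa/(_ _ _ Ecd)].
  rewrite !mnm1E [c == a]eq_sym [c == b]eq_sym (negbTE ac) (negbTE bc).
  by rewrite !t0 ?inE ?eqxx ?orbT.
by rewrite !mnm1E (negbTE ac) (negbTE ad) !t0 ?inE ?eqxx ?orbT.
Qed.

(** Gluing after specialization gives h with x_a^N h and x_c^N (1 - h) in (f, g), an ideal inside
    (x_a, x_b) and (x_c, x_d). Hence h lies in (x_c, x_d) and 1 - h in (x_a, x_b), so 1 would have
    no constant term. *)
Lemma matching_radical_generators (s : seq S) :
  radical_generators (cover_ideal E) s -> (2 < size s)%N.
Proof.
move=> [sE rad_s]; rewrite ltnNge; apply/negP => s2.
have [psi [psiX psi1]] := specialize_to_one (mem [:: a; b; c; d]).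
set f := psi s`_0; set g := psi s`_1.
have [N fgN] : exists N, forall p q, p \in [:: a; b] -> q \in [:: c; d] ->
    smul_mem [:: f; g] ('X_p ^+ N * 'X_q ^+ N : S^o).
  have /choice[N sN] : forall pq : 'I_n * 'I_n, exists N,
      pq.1 \in [:: a; b] -> pq.2 \in [:: c; d] ->
      smul_mem s (('X_(pq.1) * 'X_(pq.2) * 'X_[t]) ^+ N : S^o).
    move=> pq; have [pab|pab] := boolP (pq.1 \in [:: a; b]); last by exists 0%N.
    have [qcd|qcd] := boolP (pq.2 \in [:: c; d]); last by exists 0%N.
    by have [N ?] := rad_s _ (cover_t pab qcd); exists N.
  exists (\max_(pq : 'I_n * 'I_n) N pq) => p q pab qcd.
  have /smul_mem_pad/(smul_mem_rmorph psi) := sN (p, q) pab qcd.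
  rewrite !(rmorphXn, rmorphM) psi1 mulr1 !psiX; last first.
  - by move: pab; rewrite !inE => /orP[]->; rewrite ?orbT.
  - by move: qcd; rewrite !inE => /orP[]->; rewrite ?orbT.
  move=> /(_ s2) fgpq; rewrite -exprMn -(subnK (leq_bigmax (p, q))) exprD.
  exact: smul_memMl.
(* [psi] fixes x_i and x_j, so f and g stay in the prime of each edge inside the four vertices. *)
have fg_edge i j h : E i j -> i \in [:: a; b; c; d] -> j \in [:: a; b; c; d] ->
    smul_mem [:: f; g] (h : S^o) -> smul_mem [:: 'X_i; 'X_j] (h : S^o).
  move=> ij iabcd jabcd /smul_mem2[u [v ->]].
  have nthE (k : nat) : smul_mem [:: 'X_i; 'X_j] (psi s`_k : S^o).
    rewrite -(psiX i) // -(psiX j) //; apply: (@smul_mem_rmorph psi [:: _; _]).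
    have [ks|sk] := ltnP k (size s); last by rewrite nth_default //; exact: smul_mem0.
    apply/(@smul_mem_monomials _ _ [:: U_(i)%MM; U_(j)%MM]) => k' k's /=.
    have X_le r : (0 < k' r)%N -> (U_(r) <= k')%MM.
      by move=> k'r; apply/mnm_lepP => r'; rewrite mnm1E; case: eqP => // <-.
    by case/orP: (sE _ (mem_nth 0 ks) _ k's _ _ ij) => /X_le->; rewrite ?orbT.
  by apply: smul_memD; apply: smul_memMl; apply: nthE.
have no_const i j h : smul_mem [:: 'X_i; 'X_j] (h : S^o) -> 0%MM \notin msupp h.
  move=> /(@smul_mem_monomials _ _ [:: U_(i)%MM; U_(j)%MM]) hij.
  apply/negP => /hij /=; rewrite orbF => /orP[]/mnm_lepP/(_ _).
    by move=> /(_ i); rewrite mnm1E mnm0E eqxx.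
  by move=> /(_ j); rewrite mnm1E mnm0E eqxx.
have [? ? ?] := neqs; have /and5P[ab ac ad bc /andP[bd cd]] := neq6.
have [] := two_generated_connectedness (f := f) (g := g) (a := 'X_a ^+ N)
  (b := 'X_b ^+ N) (c := 'X_c ^+ N) (d := 'X_d ^+ N).
- exact: (@Xs_colon b [:: a; c; d] N N).
- exact: (@Xs_colon d [:: a; c] N N).
- exact: (@Xs_colon a [:: c] N N).
- exact: (@Xs_colon a [::] N N).
- exact: (@Xs_colon c [::] N N).
- by apply: X_prod_colon; rewrite // eq_sym.
- by apply: X_prod_colon; rewrite // eq_sym.
- by apply: fgN; rewrite !inE eqxx ?orbT.
- by apply: fgN; rewrite !inE eqxx ?orbT.
- by apply: fgN; rewrite !inE eqxx ?orbT.
- by apply: fgN; rewrite !inE eqxx ?orbT.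
move=> h [ha hc].
have /no_const h0 : smul_mem [:: 'X_c; 'X_d] (h : S^o).
  apply: (@Xs_colon a [:: c; d] N 1); last first.
    by apply: fg_edge ha => //; rewrite !inE eqxx ?orbT.
  by rewrite !inE !negb_or ac ad.
have /no_const h1 : smul_mem [:: 'X_a; 'X_b] (1 - h : S^o).
  apply: (@Xs_colon c [:: a; b] N 1); last first.
    by apply: fg_edge hc => //; rewrite !inE eqxx ?orbT.
  by rewrite !inE !negb_or [c == a]eq_sym [c == b]eq_sym ac bc.
have : 0%MM \in msupp (1 - h + h) by rewrite subrK msupp1 inE.
by move=> /msuppD_le; rewrite mem_cat (negbTE h0) (negbTE h1).
Qed.

End InducedMatching.
End CoverInvariants.

(** * Arithmetical rank, quotient modules and the lexicographic order in working form *)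

Section Translation.

Lemma ideal_ofE (R : comNzRingType) (s : seq R) (f : R) :
  f \in ideal_of s <-> smul_mem s (f : R^o).
Proof.
split=> [/asboolP[c ->]|].
  apply: (big_ind (@smul_mem _ R^o s)); [exact: smul_mem0|exact: smul_memD|].
  by move=> i _; apply: smul_memMl; apply: smul_mem_gen; rewrite mem_nth.
move=> sf; apply/asboolP; elim: s f sf => [|x s IH] f /=.
  by move=> ->; exists (fun=> 0); rewrite big_ord0.
move=> [u /IH[c cE]]; exists (fun i => if unlift ord0 i is Some j then c j else u).
rewrite big_ord_recl unlift_none /=; under eq_bigr => i _ do rewrite liftK /=.
by rewrite -cE [x *: u]mulrC addrC subrK.
Qed.

Lemma is_araI (R : comNzRingType) (W : submodClosed R^o) (s : seq R) :
  radical_generators (fun f => f \in W) s ->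
  (forall s', radical_generators (fun f => f \in W) s' -> (size s <= size s')%N) ->
  is_ara (R := R) W (size s).
Proof.
have radE s' : {subset s' <= W} ->
    radical (W : {pred R}) =i radical (ideal_of s') <->
    (forall f, f \in W -> rad_mem s' f).
  move=> s'W; split=> [rW f Wf|rW f].
    have : f \in radical (W : {pred R}) by apply/asboolP; exists 1%N.
    by rewrite rW => /asboolP[k /ideal_ofE]; exists k.
  apply/asboolP/asboolP=> -[k].
    by move=> /rW/rad_memX[l /ideal_ofE]; exists l.
  move=> /asboolP[c fE]; exists k; rewrite fE; apply: (@rpred_sum _ W) => i _.
  by apply: (@rpredZ _ _ W); apply: s'W; rewrite mem_nth.
move=> [sW srad] smin; split.
  by exists (in_tuple s) => //; apply/radE.
move=> m [t tW tE]; rewrite -(size_tuple t); apply: smin.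
by split; [exact: tW|exact/radE].
Qed.

Lemma quot_mod_pi (R : nzRingType) (V : lmodType R) (W : submodClosed V) :
  exists pi : {linear V -> quot_mod W},
    (forall y, exists f, pi f = y) /\ (forall f, pi f = 0 <-> f \in W).
Proof.
have lin : linear (\pi_(quot_mod W) : V -> quot_mod W).
  move=> r x y; rewrite -pi_quotD; congr (_ + _); exact/esym/pi_quotZ.
pose m := GRing.isLinear.Build R V (quot_mod W) *:%R _ lin.
have [pi piE] : exists pi : {linear V -> quot_mod W}, pi =1 \pi_(quot_mod W).
  by exists (HB.pack_for {linear V -> quot_mod W}
               (\pi_(quot_mod W) : V -> quot_mod W) m).
exists pi; split=> [y|f]; first by exists (repr y); rewrite piE reprK.
by rewrite -[0](linear0 pi) !piE -[f in f \in W]subr0 -quot_eq; split=> /eqP.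
Qed.

Variable n : nat.
Implicit Types (u v w : 'X_{1..n}) (p q r s : 'I_n).

Lemma lex_ge_refl u : lex_ge u u.
Proof. exact: lexx. Qed.

Lemma lex_gt u v r : (forall i : 'I_n, (i < r)%N -> u i = v i) ->
  (v r < u r)%N -> lex_ge u v && ~~ lex_ge v u.
Proof.
move=> uv vu; rewrite /lex_ge andbC -ltNge.
have uv' : ((val v : n.-tuplelexi nat) < (val u : n.-tuplelexi nat))%O.
  apply/ltxi_tuplePlt; exists r => [i /uv|]; first by rewrite !mnm_tnth.
  by move: vu; rewrite !mnm_tnth.
by rewrite uv' ltW.
Qed.

(** Strict comparisons are read off at the smallest index where the exponents differ; as [lex_gt]
    also denies the converse, they settle every case but equality. *)
Lemma lex_ge_edges p q r s : (p < q)%N -> (r < s)%N ->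
  lex_ge (U_(p) + U_(q)) (U_(r) + U_(s)) = (p < r)%N || (p == r) && (q <= s)%N.
Proof.
move=> pq rs.
have first p' q' r' s' : (p' < q')%N -> (r' < s')%N -> (p' < r')%N ->
    lex_ge (U_(p') + U_(q')) (U_(r') + U_(s')) &&
    ~~ lex_ge (U_(r') + U_(s')) (U_(p') + U_(q')).
  move=> pq' rs' pr'; apply: (@lex_gt _ _ p') => [i ip|].
    by rewrite !mnmDE !mnm1E -!val_eqE /=; lia.
  by rewrite !mnmDE !mnm1E -!val_eqE /=; lia.
have second p' q' s' : (p' < q')%N -> (p' < s')%N -> (q' < s')%N ->
    lex_ge (U_(p') + U_(q')) (U_(p') + U_(s')) &&
    ~~ lex_ge (U_(p') + U_(s')) (U_(p') + U_(q')).
  move=> pq' ps' qs'; apply: (@lex_gt _ _ q') => [i ip|].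
    by rewrite !mnmDE !mnm1E -!val_eqE /=; lia.
  by rewrite !mnmDE !mnm1E -!val_eqE /=; lia.
case: (ltngtP p r) => [pr|rp|/val_inj pr].
- by have /andP[-> _] := first _ _ _ _ pq rs pr.
- have /andP[_ /negbTE->] := first _ _ _ _ rs pq rp.
  by rewrite -val_eqE /= gtn_eqF.
- subst r; rewrite eqxx /=; case: (ltngtP q s) => [qs|sq|/val_inj->].
  + by have /andP[-> _] := second _ _ _ pq rs qs.
  + by have /andP[_ /negbTE->] := second _ _ _ rs pq sq.
  + exact: lex_ge_refl.
Qed.

Lemma sqfree_deg2P w : reflect
  (exists p q, (p < q)%N /\ w = (U_(p) + U_(q))%MM) (sqfree_deg2 w).
Proof.
apply: (iffP andP) => [[/forallP w1 /eqP w2]|[p [q [pq ->]]]]; last first.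
  split; last by rewrite mdegD !mdeg1.
  by apply/forallP => i; rewrite mnmDE !mnm1E -!val_eqE /=; lia.
have [p wp] : exists p, (0 < w p)%N.
  apply/existsP; rewrite -[X in is_true X]negbK negb_exists; apply/negP => /forallP w0.
  suff w0' : w = 0%MM by rewrite w0' mdeg0 in w2.
  by apply/mnmP => i; rewrite mnm0E; apply/eqP; rewrite -leqn0 leqNgt.
have pw : (U_(p) <= w)%MM by apply/mnm_lepP => i; rewrite mnm1E; case: eqP => // <-.
have /mdeg1P[q /eqP wq] : mdeg (w - U_(p)) == 1%N.
  by rewrite -(eqn_add2r (mdeg U_(p)%MM)) -mdegD submK // w2 mdeg1.
have wE : w = (U_(q) + U_(p))%MM by rewrite -wq submK.
case: (ltngtP p q) => [pq|qp|/val_inj pq].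
- by exists p, q; rewrite wE addmC.
- by exists q, p.
- by have := w1 p; rewrite wE pq mnmDE !mnm1E eqxx.
Qed.

End Translation.

(** * Lexsegment graphs *)

Section SegmentCombinatorics.
Local Open Scope nat_scope.

(** The pairs between (a, b) and (c, d) in lexicographic order, a smaller pair being a larger
    monomial; stated over [nat] for linear arithmetic. *)
Definition segment_rel (a b c d : nat) : rel nat :=
  [rel i j | [&& (i < j)%N, (a < i)%N || (a == i) && (b <= j)%N
               & (i < c)%N || (i == c) && (j <= d)%N]].

Lemma segment_relP a b c d i j : segment_rel a b c d i j <->
  i < j /\ (a < i \/ a = i /\ b <= j) /\ (i < c \/ i = c /\ j <= d).
Proof. by rewrite /segment_rel /=; lia. Qed.

(* Sources are added in decreasing order, except that a is added right after t,
   when its neighbourhood {j | b <= j} covers the edges present. *)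
Lemma segment_elimination n a b c d i i' j j' :
  let t := if b <= c then b else if b == c.+1 then c else c.+1 in
  let key i := if i == a then (n - t).*2.+1 else (n - i).*2 in
  i < n -> i' < n -> j < n -> j' < n -> b < n -> d < n ->
  a < b -> c < d -> a <= c -> [&& c.+1 < b, d < n.-1 & a < c] = false ->
  segment_rel a b c d i j -> segment_rel a b c d i' j' -> key i' < key i ->
  ~~ segment_rel a b c d i' i &&
  (segment_rel a b c d i i' || segment_rel a b c d i j').
Proof.
move=> t key Hi Hi' Hj Hj' Hb Hd ab cd ac gap.
move=> /segment_relP E1 /segment_relP E2.
suff H : (key i' < key i) -> ~ segment_rel a b c d i' i /\
    (segment_rel a b c d i i' \/ segment_rel a b c d i j').
  by move=> /H[/negP-> /orP].
rewrite !segment_relP /key {key}.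
have {gap} gap : b <= c.+1 \/ d = n.-1 \/ a = c.
  move/negbT: gap; rewrite !negb_and -!leqNgt => /or3P[] H; clear -H ac Hd; lia.
(* In the first case the sources before a are at least b, so they are neighbours of a. In the second
   only c can precede a, and its neighbours are at least b. In the third a comes first, and the
   neighbours of c must cover its edges, which is where d = n - 1 or a = c enters. *)
have {t} [t [-> ht]] : exists t', t = t' /\ ((b <= c /\ t' = b) \/
    (b = c.+1 /\ t' = c) \/ (c.+1 < b /\ t' = c.+1)).
  exists t; split=> //; rewrite /t; case: (leqP b c) => [bc|cb]; first by left.
  by case: (b =P c.+1) => bc; right; [left|right]; split=> //; lia.
by case: eqP => ia; case: eqP => ia' => H; lia.
Qed.

End SegmentCombinatorics.

Section LexSegments.
Variables (K : fieldType) (n : nat).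
Local Notation S := {mpoly K[n]}.
Implicit Types (E : rel 'I_n).

(** The dual ranges over all ordered pairs; commutativity and the absence of squares in G reduce it
    to i < j. *)
Lemma alexander_dualE (G : pred 'X_{1..n}) (f : S) :
  (forall i : 'I_n, (U_(i) + U_(i))%MM \notin G) ->
  f \in alexander_dual K G <->
  cover_ideal [rel i j : 'I_n | (i < j)%N && ((U_(i) + U_(j))%MM \in G)] f.
Proof.
move=> Girr.
have edge a b : f \in ideal_of [:: 'X_a; 'X_b : S] <->
    forall k, k \in msupp f -> (0 < k a)%N || (0 < k b)%N.
  rewrite ideal_ofE (smul_mem_monomials [:: U_(a)%MM; U_(b)%MM]).
  have X_le r (k : 'X_{1..n}) : (U_(r) <= k)%MM = (0 < k r)%N.
    apply/mnm_lepP/idP => [/(_ r)|kr i]; rewrite mnm1E ?eqxx //.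
    by case: eqP => // <-.
  by split=> fk k /fk /=; rewrite !X_le orbF.
split=> [/asboolP Gf k kf i j /= /andP[_ ij]|Ef].
  by have /edge := Gf i j ij; apply.
apply/asboolP => i j ij; apply/edge => k kf.
case: (ltngtP i j) => [lij|lji|/val_inj eij].
- by apply: (Ef k kf); rewrite /= lij.
- by rewrite orbC; apply: (Ef k kf); rewrite /= lji addmC.
- by have := Girr i; rewrite {2}eij ij.
Qed.

Lemma radical_generators_ext (R : comNzRingType) (I J : R -> Prop) (s : seq R) :
  (forall f, I f <-> J f) -> radical_generators I s -> radical_generators J s.
Proof. by move=> IJ [sI Is]; split=> f; [move/sI/IJ|move/IJ/Is]. Qed.

Lemma height2_ara_projdim E (W : submodClosed S^o) (p q : 'I_n) :
    (forall f, f \in W <-> cover_ideal E f) -> height2_tame K E ->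
    E p q -> (forall i, ~~ E i i) ->
  is_ara (R := S) W 2 /\ is_projdim (quot_mod W) 2.
Proof.
move=> WE [rE [g [h gh]]] pq Eirr.
have EW f : cover_ideal E f <-> f \in W by rewrite WE.
split.
  apply: (@is_araI S W [:: g; h]); first exact: radical_generators_ext gh.
  move=> s /(radical_generators_ext WE) sE.
  exact: (edge_radical_generators pq Eirr sE).
have [pi [piS piW]] := quot_mod_pi W.
have piE f : pi f = 0 <-> cover_ideal E f by rewrite piW.
split; first exact: pd_le1_projdim piS piE rE.
move=> m; exact: (edge_projdim pq Eirr piE).
Qed.

Lemma cone_ara_projdim E (W : submodClosed S^o) (x a b c d : 'I_n) :
    (forall f, f \in W <-> cover_ideal E f) ->
    (forall i, ~~ E i x) -> height2_tame K (del_source E x) ->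
    height2_tame K (avoid (del_source E x) (E x)) ->
    uniq [:: a; b; c; d] -> E a b -> E c d -> (forall i, ~~ E i i) ->
    (forall i j, E i j -> i \in [:: a; b; c; d] -> j \in [:: a; b; c; d] ->
     (i \in [:: a; b]) && (j \in [:: a; b]) ||
     (i \in [:: c; d]) && (j \in [:: c; d])) ->
  is_ara (R := S) W 3 /\ is_projdim (quot_mod W) 3.
Proof.
move=> WE Ex tame' tame'' abcd ab cd Eirr induced.
have EW f : cover_ideal E f <-> f \in W by rewrite WE.
split.
  have [s [s3 sE]] := cone_radical_generators Ex tame'; rewrite -s3.
  apply: (@is_araI S W s); first exact: radical_generators_ext sE.
  move=> s' /(radical_generators_ext WE) s'E; rewrite s3.
  exact: (matching_radical_generators abcd ab cd Eirr induced s'E).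
have [pi [piS piW]] := quot_mod_pi W.
have piE f : pi f = 0 <-> cover_ideal E f by rewrite piW.
split; first exact: (cone_projdim_le Ex tame' tame'' piS piE).
move=> m; exact: (matching_projdim abcd ab cd Eirr induced piS piE).
Qed.

Lemma lexseg_rel (a b c d i j : 'I_n) : (a < b)%N -> (c < d)%N ->
  (i < j)%N && ((U_(i) + U_(j))%MM \in
    lexseg (U_(a) + U_(b))%MM (U_(c) + U_(d))%MM) = segment_rel a b c d i j.
Proof.
move=> ab cd; rewrite /segment_rel /=; case: ltnP => //= ij.
rewrite inE !lex_ge_edges // -!val_eqE /=.
by have -> : sqfree_deg2 (U_(i) + U_(j))%MM by apply/sqfree_deg2P; exists i, j.
Qed.

Section Segment.
Variables (a b c d : 'I_n).
Hypotheses (ab : (a < b)%N) (cd : (c < d)%N) (ac : (a <= c)%N).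
Let E : rel 'I_n := [rel i j : 'I_n | segment_rel a b c d i j].

Let Eirr i : ~~ E i i.
Proof. by rewrite /E /segment_rel /= ltnn. Qed.

Lemma segment_tame : [&& c.+1 < b, d < n.-1 & a < c]%N = false ->
  height2_tame K E.
Proof.
move=> nogap.
pose t := if (b <= c)%N then nat_of_ord b
          else if b == c.+1 :> nat then nat_of_ord c else c.+1.
pose key (i : 'I_n) := if i == a :> nat then (n - t).*2.+1 else (n - i).*2.
apply: (@elimination_tame K n E key) => //.
  move=> i i' j j' _ _; rewrite /key => H; apply/val_inj => /=; move: H.
  move: (ltn_ord i) (ltn_ord i') => ? ?.
  by do 2![case: eqP]; lia.
by move=> i i' j j'; apply: segment_elimination.
Qed.

Hypothesis gap : [&& c.+1 < b, d < n.-1 & a < c]%N.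

Lemma segment_source i : ~~ E i a.
Proof. apply/negP => /segment_relP; lia. Qed.

(** Sources are added in decreasing order. Once a is deleted, a source below an earlier one lies
    strictly between a and c, so it is adjacent to every larger vertex, in particular to the earlier
    source. *)
Lemma segment_del_tame : height2_tame K (del_source E a).
Proof.
apply: (@elimination_tame K n _ (fun i => n - i)%N).
- move=> i i' j j' _ _ H; apply/val_inj => /=; move: H (ltn_ord i) (ltn_ord i'); lia.
- by move=> i; rewrite /del_source /= (negbTE (Eirr i)).
- move=> i i' j j' /andP[/segment_relP ij ia] /andP[/segment_relP ij' ia'] ii'.
  apply/andP; split.
    apply/negP => /andP[/segment_relP]; lia.
  apply/orP; left; apply/andP; split=> //; apply/segment_relP.
  move: ia ia'; rewrite -!val_eqE /=; lia.
Qed.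

(** The same order works: the edge between two sources survives because both avoid the neighbours of
    a. *)
Lemma segment_avoid_tame : height2_tame K (avoid (del_source E a) (E a)).
Proof.
apply: (@elimination_tame K n _ (fun i => n - i)%N).
- move=> i i' j j' _ _ H; apply/val_inj => /=; move: H (ltn_ord i) (ltn_ord i'); lia.
- by move=> i; rewrite /avoid /del_source /= (negbTE (Eirr i)).
- move=> i i' j j' /and3P[/andP[/segment_relP ij ia] iA jA].
  move=> /and3P[/andP[/segment_relP ij' ia'] iA' jA'] ii'.
  apply/andP; split.
    apply/negP => /and3P[/andP[/segment_relP]]; lia.
  apply/orP; left; apply/and3P; split=> //; apply/andP; split=> //; apply/segment_relP.
  move: ia ia'; rewrite -!val_eqE /=; lia.
Qed.

End Segment.

Lemma segment_ara_projdim (a b c d : 'I_n) (W : submodClosed S^o) :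
    (a < b)%N -> (c < d)%N -> (a <= c)%N -> (a = c -> b <= d)%N ->
    (forall f, f \in W <->
       cover_ideal [rel i j : 'I_n | segment_rel a b c d i j] f) ->
  exists r, is_ara (R := S) W r /\ is_projdim (quot_mod W) r.
Proof.
move=> ab cd ac abd WE.
have Eab : segment_rel a b c d a b.
  have abd' : a = c :> nat -> (b <= d)%N by move=> /val_inj/abd.
  by apply/segment_relP; lia.
have Eirr (i : 'I_n) : ~~ segment_rel a b c d i i by rewrite /segment_rel /= ltnn.
(* A gap makes {a, n-1} and {c, c+1} an induced pair of disjoint edges: b > c + 1 separates a from c
   and c + 1, d < n - 1 separates c from n - 1, and c + 1 is not a source. *)
have [gap|nogap] := boolP [&& c.+1 < b, d < n.-1 & a < c]%N; last first.
  exists 2%N; apply: (height2_ara_projdim WE _ Eab) => //.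
  by apply: segment_tame => //; apply/negbTE.
have zn : (n.-1 < n)%N by move: (ltn_ord a); lia.
have yn : (c.+1 < n)%N by move: (ltn_ord b) gap; lia.
exists 3%N; apply: (cone_ara_projdim (x := a) (a := a) (b := Ordinal zn)
  (c := c) (d := Ordinal yn) WE) => //.
- exact: segment_source.
- exact: segment_del_tame.
- exact: segment_avoid_tame.
- rewrite /= !inE -!val_eqE /=; move: (ltn_ord d) (ltn_ord b) gap; lia.
- apply/segment_relP; move: (ltn_ord d) (ltn_ord b) gap => /=; lia.
- apply/segment_relP; move: (ltn_ord d) (ltn_ord b) gap => /=; lia.
- move=> i j /segment_relP; move: (ltn_ord d) (ltn_ord b) gap.
  rewrite !inE -!val_eqE /= => dn bn /and3P[cb dn' ac'] ij.
  by move=> /or4P[]/eqP ie /or4P[]/eqP je; lia.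
Qed.

End LexSegments.

Theorem theorem3p2 (K : fieldType) (n : nat) (u v : 'X_{1..n})
    (hu : sqfree_deg2 u) (hv : sqfree_deg2 v) (huv : lex_ge u v) :
  exists r : nat,
    is_ara (R := {mpoly K[n]}) (alexander_dual K (lexseg u v)) r /\
    is_projdim (R := {mpoly K[n]})
      (quot_mod (alexander_dual K (lexseg u v))) r.
Proof.
have /sqfree_deg2P[a [b [ab uE]]] := hu; have /sqfree_deg2P[c [d [cd vE]]] := hv.
subst u v; have := huv; rewrite lex_ge_edges // => acbd.
have acbd' : (a < c)%N \/ a = c /\ (b <= d)%N.
  by case/orP: acbd => [|/andP[/eqP]]; [left|right].
apply: (@segment_ara_projdim K n a b c d) => // [||f].
- by case: acbd' => [|[->]]; [exact: ltnW|].
- by case: acbd' => [ac e|[]//]; move: ac; rewrite e ltnn.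
rewrite alexander_dualE => [|i].
  rewrite (@eq_cover_ideal K n _ [rel i j : 'I_n | segment_rel a b c d i j]) // => i j.
  exact: lexseg_rel.
rewrite inE negb_and; apply/orP; left; apply/negP => /andP[/forallP/(_ i)].
by rewrite mnmDE mnm1E eqxx.
Qed.
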